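(* A hereditary class $\mathcal C$ of finite graphs is minimal prime if and only if $\mathcal C=\mathrm{Age}(G_\mu)$ for some uniformly recurrent $0$-$1$ word $\mu$ on $\mathbb N$, or $\mathcal C\in\mathcal L$, where $\mathcal L$ is the list of eleven ages $$\mathcal L=\{\mathrm{Age}(S),\mathrm{Age}(\overline S),\mathrm{Age}(B),\mathrm{Age}(\overline B),\mathrm{Age}(M),\mathrm{Age}(\overline M),\mathrm{Age}(T),\mathrm{Age}(\overline T),\mathrm{Age}(D),\mathrm{Age}(F),\mathrm{Age}(\overline F)\}.$$
   Context: Graphs are simple, undirected, loopless; $\overline G$ is the complement of $G$. A graph $G$ embeds in $G'$ if it is isomorphic to an induced subgraph of $G'$. A class of finite graphs is hereditary if it is closed under embedded graphs. $\mathrm{Age}(G)$ is the class of finite graphs, up to isomorphism, that embed in $G$. A module of $G=(V,E)$ is a set $A\subseteq V$ such that each $x\in V\setminus A$ is adjacent to all or to none of the elements of $A$; $G$ is prime if its only modules are $\emptyset$, the singletons and $V$. A hereditary class is minimal prime if it contains infinitely many prime graphs (up to isomorphism), while every proper hereditary subclass contains only finitely many. For a word $\mu:\mathbb N\to\{0,1\}$, $G_\mu$ is the graph with vertex set $\{-1\}\cup\mathbb N$ in which, for $i<j$, $\{i,j\}$ is an edge iff ($\mu_j=1$ and $j=i+1$) or ($\mu_j=0$ and $j\ne i+1$). The word $\mu$ is uniformly recurrent if for every $n$ there is $m$ such that each factor (finite block of consecutive letters) of $\mu$ of length $n$ occurs in every factor of $\mu$ of length $m$. The graphs of the list (indices $i,j$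 range over $\mathbb N$; only the listed edges are present): - $S$ (subdivided star): vertices $c,u_i,v_i$; edges $cu_i$ and $u_iv_i$ for all $i$. - $B$ (half-graph): vertices $a_i,b_j$; edges $a_ib_j$ for $i\le j$. - $M$ (complete bipartite graph minus a perfect matching): vertices $a_i,b_j$; edges $a_ib_j$ for $i\ne j$. - $T$ (thin spider): vertices $a_i,b_i$; edges $a_ia_j$ for $i\neq j$, and $a_ib_i$ for all $i$. - $D$: vertices $x,a_i,b_j$; edges $b_ib_j$ for $i\ne j$, $a_ib_j$ for $i\ge j$, and $xa_i$ for all $i$. - $F$: vertices $x,a_\infty,a_i,b_j$; edges $b_ib_j$ for $i\neq j$, $a_ib_j$ for $i\ge j$, $a_\infty b_j$ for all $j$, and $xa_\infty$. *)

(* Defs.v *)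
From Stdlib Require List.
From HB Require Import structures.
From mathcomp Require Import all_boot.

Set Implicit Arguments.
Unset Strict Implicit.
Unset Printing Implicit Defensive.

Record graph := Graph {
  vertex :> eqType;
  adj : rel vertex;
  adj_sym : symmetric adj;
  adj_irrefl : irreflexive adj }.

Record fin_graph := FinGraph {
  fin_vertex : finType;
  fin_adj : rel fin_vertex;
  fin_adj_sym : symmetric fin_adj;
  fin_adj_irrefl : irreflexive fin_adj }.

Coercion graph_of_fin (G : fin_graph) : graph :=
  Graph (@fin_adj_sym G) (@fin_adj_irrefl G).

Section Constructions.

Variables (G : graph) (A : pred G) (T : eqType) (r : rel T).

Definition compl_adj : rel G := fun x y => (x != y) && ~~ adj x y.

Lemma compl_adj_sym : symmetric compl_adj.
Proof. by move=> x y; rewrite /compl_adj eq_sym adj_sym. Qed.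

Lemma compl_adj_irrefl : irreflexive compl_adj.
Proof. by move=> x; rewrite /compl_adj eqxx. Qed.

Definition complement : graph := Graph compl_adj_sym compl_adj_irrefl.

Definition induced_adj : rel {x : G | A x} := fun x y => adj (val x) (val y).

Lemma induced_adj_sym : symmetric induced_adj.
Proof. by move=> x y; rewrite /induced_adj adj_sym. Qed.

Lemma induced_adj_irrefl : irreflexive induced_adj.
Proof. by move=> x; rewrite /induced_adj adj_irrefl. Qed.

Definition induced : graph := Graph induced_adj_sym induced_adj_irrefl.

Definition sym_adj : rel T := fun x y => r x y || r y x.

Lemma sym_adj_sym : symmetric sym_adj.
Proof. by move=> x y; rewrite /sym_adj orbC. Qed.

Lemma sym_adj_irrefl : irreflexive r -> irreflexive sym_adj.
Proof. by move=> r_irr x; rewrite /sym_adj r_irr. Qed.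

Definition graph_of_rel (r_irr : irreflexive r) : graph :=
  Graph sym_adj_sym (sym_adj_irrefl r_irr).

End Constructions.

Definition isomorphic (G H : graph) : Prop :=
  exists f : G -> H, bijective f /\ forall x y, adj (f x) (f y) = adj x y.

Definition embeds (G H : graph) : Prop :=
  exists A : pred H, isomorphic G (induced A).

Definition graph_class := fin_graph -> Prop.

Definition subclass (C D : graph_class) : Prop := forall G, C G -> D G.

Definition class_eq (C D : graph_class) : Prop := forall G, C G <-> D G.

(* Since isomorphic graphs embed in each other, a hereditary class is in
   particular closed under isomorphism. *)
Definition hereditary (C : graph_class) : Prop :=
  forall G H : fin_graph, embeds G H -> C H -> C G.

Definition Age (G : graph) : graph_class := fun H => embeds H G.

Definition is_module (G : fin_graph) (A : {set fin_vertex G}) : Prop :=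
  forall x, x \notin A ->
    (forall y, y \in A -> fin_adj x y) \/ (forall y, y \in A -> ~~ fin_adj x y).

Definition prime_graph (G : fin_graph) : Prop :=
  forall A : {set fin_vertex G}, is_module A ->
    [\/ A = set0, exists x, A = [set x] | A = setT].

Definition finitely_many_primes (C : graph_class) : Prop :=
  exists s : seq fin_graph, forall G : fin_graph, C G -> prime_graph G ->
    exists2 H : fin_graph, List.In H s & isomorphic G H.

Definition minimal_prime (C : graph_class) : Prop :=
  [/\ hereditary C,
      ~ finitely_many_primes C
    & forall D : graph_class, hereditary D -> subclass D C -> ~ class_eq D C ->
        finitely_many_primes D].

Definition word := nat -> bool.

Definition factor (mu : word) (p n : nat) : seq bool :=
  mkseq (fun k => mu (p + k)) n.

Definition uniformly_recurrent (mu : word) : Prop :=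
  forall n, exists m, forall p q, infix (factor mu p n) (factor mu q m).

(* The vertex set {-1, 0, 1, ...} of the graph of a word is [option nat], with
   [None] for -1. Thus [word_succ i] is i + 1, and i < j for j : nat means
   [word_succ i <= j]. *)
Definition word_succ (i : option nat) : nat := if i is Some k then k.+1 else 0.

Definition word_rel (mu : word) : rel (option nat) := fun i j' =>
  if j' is Some j then
    (word_succ i <= j) &&
    ((mu j && (j == word_succ i)) || (~~ mu j && (j != word_succ i)))
  else false.

Lemma word_rel_irrefl mu : irreflexive (word_rel mu).
Proof. by case=> [i|] //=; rewrite ltnn. Qed.

Definition G_word (mu : word) : graph := graph_of_rel (@word_rel_irrefl mu).

(* c = [None], u_i = [Some (inl i)], v_i = [Some (inr i)] *)
Definition S_rel : rel (option (nat + nat)) := fun p q =>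
  match p, q with
  | None, Some (inl _) => true
  | Some (inl i), Some (inr j) => i == j
  | _, _ => false
  end.

Lemma S_rel_irrefl : irreflexive S_rel.
Proof. by case=> [[]|]. Qed.

Definition graph_S : graph := graph_of_rel S_rel_irrefl.

(* In B, M and T: a_i = [inl i], b_j = [inr j] *)
Definition B_rel : rel (nat + nat) := fun p q =>
  if (p, q) is (inl i, inr j) then i <= j else false.

Lemma B_rel_irrefl : irreflexive B_rel.
Proof. by case. Qed.

Definition graph_B : graph := graph_of_rel B_rel_irrefl.

Definition M_rel : rel (nat + nat) := fun p q =>
  if (p, q) is (inl i, inr j) then i != j else false.

Lemma M_rel_irrefl : irreflexive M_rel.
Proof. by case. Qed.

Definition graph_M : graph := graph_of_rel M_rel_irrefl.

Definition T_rel : rel (nat + nat) := fun p q =>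
  match p, q with
  | inl i, inl j => i != j
  | inl i, inr j => i == j
  | _, _ => false
  end.

Lemma T_rel_irrefl : irreflexive T_rel.
Proof. by case=> i //=; rewrite eqxx. Qed.

Definition graph_T : graph := graph_of_rel T_rel_irrefl.

(* x = [None], a_i = [Some (inl i)], b_j = [Some (inr j)] *)
Definition D_rel : rel (option (nat + nat)) := fun p q =>
  match p, q with
  | Some (inr i), Some (inr j) => i != j
  | Some (inl i), Some (inr j) => i >= j
  | None, Some (inl _) => true
  | _, _ => false
  end.

Lemma D_rel_irrefl : irreflexive D_rel.
Proof. by case=> [[]|] //= i; rewrite eqxx. Qed.

Definition graph_D : graph := graph_of_rel D_rel_irrefl.

(* x = [None], a_oo = [Some (inl None)], a_i = [Some (inl (Some i))],
   b_j = [Some (inr j)] *)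
Definition F_rel : rel (option (option nat + nat)) := fun p q =>
  match p, q with
  | Some (inr i), Some (inr j) => i != j
  | Some (inl (Some i)), Some (inr j) => i >= j
  | Some (inl None), Some (inr _) => true
  | None, Some (inl None) => true
  | _, _ => false
  end.

Lemma F_rel_irrefl : irreflexive F_rel.
Proof. by case=> [[[]|]|] //= i; rewrite eqxx. Qed.

Definition graph_F : graph := graph_of_rel F_rel_irrefl.

Definition list_L : seq graph_class :=
  [:: Age graph_S; Age (complement graph_S);
      Age graph_B; Age (complement graph_B);
      Age graph_M; Age (complement graph_M);
      Age graph_T; Age (complement graph_T);
      Age graph_D;
      Age graph_F; Age (complement graph_F)].

(* Main.v *)
Require Import Defs.
From Stdlib Require List.
From Stdlib Require Import Classical ClassicalEpsilon.
From mathcomp Require Import all_boot zify.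

(* A word graph grows by adding vertices that see all their predecessors but the
   last one alike.  In a prime graph, any pair of vertices is joined to any third
   vertex by such a chain, since the set reached from the pair is a module.  So
   if a hereditary class with infinitely many prime graphs has unboundedly long
   chains, a minimal infinite factorial language of words yields a uniformly
   recurrent word.  If chains are bounded, then Ramsey's theorem turns many
   chains to a common vertex into an array with rows of bounded length, whose
   adjacencies depend only on the columns and on the order of the rows; a
   finite case analysis, done by computation on these patterns, finds one of the
   eleven graphs.  Conversely, a large prime graph of the age of one of
   these graphs contains all small ones, since two vertices of a column
   have to be separated by a vertex of the other column in a row between, and a
   missing constant vertex makes a tail of rows a module; and a prime graph in
   the age of a word graph is an interval, up to its first vertex. *)

Set Implicit Arguments.
Unset Strict Implicit.
Unset Printing Implicit Defensive.

(** * Embeddings and prime graphs *)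

(** Two columns alone do not suffice. Repeatedly halving a prime graph gives pairs in which the
    second vertex separates the first vertex of its row from those of all later rows. Among the
    two-column patterns so obtained, those left without a listed graph are the induced matching and
    its complement, where each row is a module, and [half_split], where each tail of rows is one.
    Primality of the surrounding graph is used again to break these modules: chains lead from the
    rows to one fixed vertex, whose column is the same vertex in every row. Adding the columns of
    the chains one at a time, the bad configuration either yields a listed graph or passes on to the
    next column; the constant last column is incompatible with it, so the process ends with a listed
    graph. *)

Definition emb (G H : graph) : Prop :=
  exists f : G -> H, injective f /\ forall x y, adj (f x) (f y) = adj x y.

Lemma emb_trans (G H K : graph) : emb G H -> emb H K -> emb G K.
Proof.
move=> [f [fI fA]] [g [gI gA]]; exists (g \o f); split; first exact: inj_comp.
by move=> x y /=; rewrite gA fA.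
Qed.

Lemma embedsP (G : fin_graph) (H : graph) : embeds G H <-> emb G H.
Proof.
split=> [[A [f [fB fA]]]|[f [fI fA]]].
  exists (fun x => val (f x)); split; last by move=> x y; rewrite -fA.
  by move=> x y /val_inj; apply: bij_inj fB _ _.
pose A : pred H := fun y => [exists x : fin_vertex G, f x == y].
have fA' x : A (f x) by apply/existsP; exists x.
exists A, (fun x => exist _ (f x) (fA' x)); split; last by move=> x y; rewrite -fA.
have gP (y : {y : H | A y}) : exists x : fin_vertex G, f x == val y.
  by case: y => y /= /existsP.
exists (fun y => xchoose (gP y)) => [x|y].
  by apply: fI; have /eqP := xchooseP (gP (exist _ (f x) (fA' x))).
by apply: val_inj => /=; apply/eqP/(xchooseP (gP y)).
Qed.

Lemma isomorphic_card (G H : fin_graph) :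
  isomorphic G H -> #|fin_vertex G| = #|fin_vertex H|.
Proof. by move=> [f [fB _]]; apply: (@bij_eq_card (fin_vertex G) (fin_vertex H) f). Qed.

Lemma unbounded_primes (C : graph_class) :
  (forall N, exists G, [/\ C G, prime_graph G & N <= #|fin_vertex G|]) ->
  ~ finitely_many_primes C.
Proof.
move=> big [s sP].
have [N NP] : exists N, forall H : fin_graph, List.In H s -> #|fin_vertex H| < N.
  elim: s {sP} => [|H s [N IH]]; first by exists 0.
  exists (maxn N #|fin_vertex H|.+1) => K /= [<-|/IH lt]; first exact: leq_maxr.
  exact: leq_trans lt (leq_maxl _ _).
have [G [CG pG]] := big N.
have [H Hs /isomorphic_card ->] := sP G CG pG.
by rewrite leqNgt NP.
Qed.

(** Symmetrized and made loopless, so that every finite function codes a graph and the graphs on [n]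
    vertices can be listed by [enum]. *)
Definition ffun_rel n (r : {ffun 'I_n * 'I_n -> bool}) : rel 'I_n :=
  fun x y => (x != y) && (r (x, y) || r (y, x)).

Lemma ffun_rel_sym n r : symmetric (@ffun_rel n r).
Proof. by move=> x y; rewrite /ffun_rel eq_sym orbC. Qed.

Lemma ffun_rel_irrefl n r : irreflexive (@ffun_rel n r).
Proof. by move=> x; rewrite /ffun_rel eqxx. Qed.

Definition ffun_graph n (r : {ffun 'I_n * 'I_n -> bool}) : fin_graph :=
  FinGraph (@ffun_rel_sym n r) (@ffun_rel_irrefl n r).

Lemma bounded_primes (C : graph_class) N :
  (forall G, C G -> prime_graph G -> #|fin_vertex G| < N) ->
  finitely_many_primes C.
Proof.
move=> bnd.
pose graphs n := List.map (@ffun_graph n) (enum {: {ffun 'I_n * 'I_n -> bool}}).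
have in_mem (T : eqType) (x : T) s : x \in s -> List.In x s.
  elim: s => //= y s IH; rewrite inE => /predU1P[->|/IH]; by [left|right].
exists (List.flat_map graphs (iota 0 N)) => G CG pG.
pose n := #|fin_vertex G|.
pose e (i : 'I_n) : fin_vertex G := enum_val i.
pose r : {ffun 'I_n * 'I_n -> bool} := [ffun p => fin_adj (e p.1) (e p.2)].
exists (ffun_graph r).
  apply/List.in_flat_map; exists n; split.
    by apply: in_mem; rewrite mem_iota /= add0n; apply: bnd.
  by apply/List.in_map/in_mem; rewrite mem_enum.
exists (fun x : G => enum_rank (x : fin_vertex G) : vertex (ffun_graph r)); split.
  by exists e; [exact: enum_rankK|exact: enum_valK].
move=> x y; rewrite /adj /= /ffun_rel !ffunE /e /= !enum_rankK.
rewrite (inj_eq enum_rank_inj) [fin_adj y x]fin_adj_sym orbb.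
by case: eqP => //= ->; rewrite fin_adj_irrefl.
Qed.

Lemma large_primes (C : graph_class) :
  ~ finitely_many_primes C ->
  forall N, exists G, [/\ C G, prime_graph G & N <= #|fin_vertex G|].
Proof.
move=> inf N; apply: NNPP => none; apply/inf/(@bounded_primes _ N) => G CG pG.
by rewrite ltnNge; apply/negP => le; apply: none; exists G.
Qed.

(** A proper hereditary subclass misses some [H] of [C]; as [H] embeds in every large prime member
    of [C], the primes of the subclass are bounded in size. *)
Lemma minimal_primeI (C : graph_class) :
  hereditary C ->
  (forall N, exists G, [/\ C G, prime_graph G & N <= #|fin_vertex G|]) ->
  (forall H, C H -> exists N, forall G, C G -> prime_graph G ->
     N <= #|fin_vertex G| -> emb H G) ->
  minimal_prime C.
Proof.
move=> hC big sub; split=> //; first exact: unbounded_primes.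
move=> D hD DC neq.
have [H CH nDH] : exists2 H, C H & ~ D H.
  apply: NNPP => none; apply: neq => H; split; first exact: DC.
  by move=> CH; apply: NNPP => nDH; apply: none; exists H.
have [N NP] := sub H CH.
apply: (@bounded_primes _ N) => G DG pG; rewrite ltnNge; apply/negP => le.
by apply/nDH/(hD _ G) => //; apply/embedsP/NP => //; apply: DC.
Qed.

Lemma minimal_prime_eq (C D : graph_class) :
  class_eq C D -> minimal_prime D -> minimal_prime C.
Proof.
move=> eqCD [hD infD minD]; split.
- by move=> G H GH /(proj1 (eqCD H)) DH; apply/(proj2 (eqCD G))/(hD _ H).
- move=> [s sP]; apply: infD; exists s => G DG; apply: sP.
  exact/(proj2 (eqCD G)).
- move=> E hE EC nE; apply: minD => // [G EG|EqED].
    exact/(proj1 (eqCD G))/EC.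
  by apply: nE => G; split=> [/EC //|CG]; apply/(proj2 (EqED G))/(proj1 (eqCD G)).
Qed.

(** For the direct implication: it remains to find one of the candidate ages inside [C]. *)
Lemma minimal_prime_sub (C D : graph_class) :
  minimal_prime C -> hereditary D -> ~ finitely_many_primes D ->
  subclass D C -> class_eq C D.
Proof.
move=> [_ _ min] hD infD DC; apply: NNPP => neq; apply/infD/min => // eqDC.
by apply: neq => G; split=> [CG|DG]; [exact/(proj2 (eqDC G))|exact/(proj1 (eqDC G))].
Qed.

Section Prime.

Variable G : fin_graph.
Notation V := (fin_vertex G).
Hypothesis pG : prime_graph G.

Lemma prime_module (A : {set V}) (x y : V) :
  is_module A -> x \in A -> y \in A -> x != y -> A = setT.
Proof.
move=> /pG[->|[z ->]|//]; first by rewrite inE.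
by rewrite !inE => /eqP-> /eqP->; rewrite eqxx.
Qed.

Lemma prime_distinguish (x y : V) : x != y -> 2 < #|V| ->
  exists z, [/\ z != x, z != y & fin_adj z x != fin_adj z y].
Proof.
move=> xy lt2; apply: NNPP => none.
have /prime_module - /(_ x y) : is_module [set x; y].
  move=> z; rewrite !inE => /norP[zx zy].
  have zE : fin_adj z x = fin_adj z y.
    by apply/eqP/negPn/negP => ne; apply: none; exists z.
  case zx' : (fin_adj z x); [left|right] => u; rewrite !inE => /orP[] /eqP->;
    by rewrite -?zE zx'.
rewrite !inE !eqxx orbT => /(_ isT isT xy) E.
by move: lt2; rewrite -cardsT -E cards2 xy.
Qed.

(** Two vertices with the same image would be twins, but some third vertex separates them. *)
Lemma hom_prime_inj (H : graph) (f : V -> H) : 2 < #|V| ->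
  (forall x y, adj (f x) (f y) = fin_adj x y) -> injective f.
Proof.
move=> lt2 fA x y fxy; apply/eqP/negPn/negP => /prime_distinguish[] // z [_ _].
by rewrite -!fA fxy eqxx.
Qed.

End Prime.

(** * Chains in prime graphs *)

(** With the adjacency of [p i.+1] and [p i] as letter [i], this is the graph of a word with [m]
    letters, on [m.+1] vertices. *)
Definition chain (G : fin_graph) (p : nat -> fin_vertex G) (m : nat) :=
  (forall i j, i <= m -> j <= m -> p i = p j -> i = j) /\
  (forall i j, j.+1 < i <= m ->
     fin_adj (p i) (p j) = ~~ fin_adj (p i) (p i.-1)).

Section Closure.

Variable G : fin_graph.
Notation V := (fin_vertex G).
Hypothesis pG : prime_graph G.
Variables x y : V.
Hypothesis xy : x != y.

Definition mixed (A : {set V}) (z : V) : bool :=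
  [exists u in A, fin_adj z u] && [exists u in A, ~~ fin_adj z u].

Definition layer (k : nat) : {set V} :=
  iter k (fun A => A :|: [set z | mixed A z]) [set x; y].

Lemma layerS k : layer k.+1 = layer k :|: [set z | mixed (layer k) z].
Proof. by []. Qed.

Lemma layer_xy k : (x \in layer k) && (y \in layer k).
Proof.
elim: k => [|k /andP[xk yk]]; first by rewrite !inE !eqxx orbT.
by rewrite layerS !in_setU xk yk.
Qed.

Lemma mem_layer_mono k l : k <= l -> {subset layer k <= layer l}.
Proof.
elim: l => [|l IH]; first by rewrite leqn0 => /eqP->.
rewrite leq_eqVlt => /predU1P[->//|/IH s] z /s; rewrite layerS in_setU => -> //.
Qed.

(** A layer equal to the next one is a module containing [x] and [y], hence everything. If [v] were
    never reached, the layers would grow forever. *)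
Lemma layer_cover v : exists k, v \in layer k.
Proof.
apply: NNPP => none; have vn k : v \notin layer k.
  by apply/negP => vk; apply: none; exists k.
suff card k : k <= #|layer k|.
  by have := leq_trans (card #|V|.+1) (max_card _); rewrite ltnn.
elim: k => // k IH; apply: leq_ltn_trans IH _; apply: proper_card.
rewrite properE subsetUl /=; apply/negP => sub.
have mod : is_module (layer k).
  move=> z zk; case nz : [exists u in layer k, fin_adj z u]; last first.
    by right=> u uk; move/negbT: nz; rewrite negb_exists_in => /forall_inP/(_ u uk).
  left=> u uk; apply/negPn/negP => zu; case/negP: zk; apply: (subsetP sub).
  by rewrite !inE /mixed nz /=; apply/orP; right; apply/exists_inP; exists u.
case/andP: (layer_xy k) => xk yk.
by have := vn k; rewrite (prime_module pG mod xk yk xy) inE.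
Qed.

(* A vertex of the last layer is not mixed on the layer before the previous
   one, so it is separated from it by a vertex of exactly the previous layer. *)
Lemma layer_chain k v : v \in layer k.+1 -> v \notin layer k ->
  exists p : nat -> V, [/\ p 0 = x, p 1 = y, p k.+2 = v,
    (forall i, i < k.+2 -> p i \in layer k) & chain p k.+2].
Proof.
elim: k v => [|k IH] v; rewrite layerS in_setU => /orP[->//|]; rewrite inE => mv nv.
  exists (fun i => if i is i'.+1 then if i' is _.+1 then v else y else x).
  move: nv mv; rewrite /mixed !inE => /norP[vx vy] mv.
  split=> // [[|[|]]//|]; rewrite ?inE ?eqxx ?orbT //.
  split=> [[|[|[|i]]] [|[|[|j]]] //= _ _ E|i j lt].
    - by move: xy; rewrite E eqxx.
    - by move: vx; rewrite E eqxx.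
    - by move: xy; rewrite E eqxx.
    - by move: vy; rewrite E eqxx.
    - by move: vx; rewrite E eqxx.
    - by move: vy; rewrite E eqxx.
  have [-> ->] : i = 2 /\ j = 0 by lia.
  case/andP: mv => /exists_inP[u uA vu] /exists_inP[w wA vw].
  move: uA wA vu vw; rewrite !inE.
  case/orP=> /eqP->; case/orP=> /eqP-> E1 E2; move: E1 E2;
    by case: fin_adj; case: fin_adj.
have nmv : ~~ mixed (layer k) v.
  by apply: contra nv => mv'; rewrite layerS !inE mv' orbT.
have eqv u : u \in layer k -> fin_adj v u = fin_adj v x.
  move=> uk; case/andP: (layer_xy k) => xk yk.
  move: nmv; rewrite /mixed negb_and !negb_exists_in.
  case/orP=> /forall_inP H; first by rewrite (negbTE (H u uk)) (negbTE (H x xk)).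
  by rewrite (negPn (H u uk)) (negPn (H x xk)).
have [u uk vu] : exists2 u, u \in layer k.+1 & fin_adj v u != fin_adj v x.
  case/andP: mv => /exists_inP[u uA vu] /exists_inP[w wA vw].
  case vx : (fin_adj v x); first by exists w; rewrite ?(negbTE vw).
  by exists u; rewrite ?vu.
have uk' : u \notin layer k by apply: contra vu => uk'; rewrite eqv.
have [p [p0 p1 pu pk [pI pA]]] := IH u uk uk'.
exists (fun i => if i <= k.+2 then p i else v).
have pk1 i : i <= k.+2 -> p i \in layer k.+1.
  rewrite leq_eqVlt => /predU1P[->|/pk pik]; first by rewrite pu.
  exact: mem_layer_mono pik.
split=> //; rewrite ?ltnn //; first by move=> i lt; rewrite -ltnS lt pk1.
split=> [i j le1 le2|i j /andP[ji le]].
  case: ifP => li; case: ifP => lj; first exact: pI.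
  - by move=> E; move: nv; rewrite -E pk1.
  - by move=> E; move: nv; rewrite E pk1.
  - by move=> _; move: (negbT li) (negbT lj) le1 le2; lia.
case: (leqP i k.+2) => li.
  have -> : j <= k.+2 by lia.
  have -> : i.-1 <= k.+2 by lia.
  by apply: pA; rewrite ji li.
have -> : i.-1 = k.+2 by lia.
have -> : j <= k.+2 by lia.
rewrite leqnn pu eqv; last by apply: pk; lia.
by case: fin_adj vu => //; case: fin_adj.
Qed.

Lemma chain_to v : v != x -> v != y ->
  exists m (p : nat -> V), [/\ 2 <= m, p 0 = x, p 1 = y, p m = v & chain p m].
Proof.
move=> vx vy; have [k] := layer_cover v.
elim: k => [|k IH]; first by rewrite !inE (negbTE vx) (negbTE vy).
move=> vk; case vk' : (v \in layer k); first exact: IH.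
have [p [p0 p1 pv _ pc]] := layer_chain vk (negbT vk').
by exists k.+2, p.
Qed.

End Closure.

(** * Ramsey's theorem *)

Lemma pigeonhole (T : finType) (f : nat -> T) (s : seq nat) N :
  #|T| * N < size s -> exists a, N < size [seq x <- s | f x == a].
Proof.
have sumE : \sum_a size [seq x <- s | f x == a] = size s.
  elim: s => [|x s IH]; first by rewrite big1.
  rewrite -[size (x :: s)]/((size s).+1) -IH -add1n.
  have <- : \sum_a (f x == a : nat) = 1.
    rewrite (bigD1 (f x)) //= eqxx big1 ?addn0 // => a.
    by rewrite eq_sym => /negbTE->.
  by rewrite -big_split /=; apply: eq_bigr => a _; case: eqP.
move=> lt; apply: NNPP => none; move: lt; rewrite -sumE ltnNge; case/negP.
rewrite -sum_nat_const; apply: leq_sum => a _; rewrite leqNgt; apply/negP => lt.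
by apply: none; exists a.
Qed.

Lemma prehomogeneous (T : finType) n : exists N,
  forall (c : nat -> nat -> T) (s : seq nat), uniq s -> N <= size s ->
    exists t (g : nat -> T),
      [/\ subseq t s, size t = n & pairwise (fun x y => c x y == g x) t].
Proof.
elim: n => [|n [N IH]].
  exists 0 => c s _ _; case: (pickP T) => [a _|T0].
    by exists [::], (fun=> a); rewrite sub0seq.
  (* With [T] empty, a function into [T] can only be made from [c]. *)
  by exists [::], (fun x => c x x); rewrite sub0seq.
exists (#|T| * N).+2 => c [//|x s] /= /andP[xs us] lt.
have [a Na] := @pigeonhole T (c x) s N lt.
have [t [g [ts <- tg]]] := IH c _ (filter_uniq _ us) (ltnW Na).
exists (x :: t), (fun z => if z == x then a else g z).
have subt : {subset t <= [seq y <- s | c x y == a]} by apply: mem_subseq.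
split=> //=; first by rewrite eqxx; apply: subseq_trans ts (filter_subseq _ _).
rewrite eqxx; apply/andP; split.
  by apply/allP => y /subt; rewrite mem_filter => /andP[].
apply/(pairwiseP 0) => i j it jt ij.
have /eqP cE := pairwiseP 0 tg i j it jt ij; rewrite /= cE.
case: ifP (subt _ (mem_nth 0 it)) => [/eqP->|_ _]; last by rewrite eqxx.
by rewrite mem_filter (negbTE xs) andbF.
Qed.

Lemma ramsey (T : finType) n : exists N, forall c : nat -> nat -> T,
  exists g a, [/\ forall k l, k < l < n -> g k < g l,
    forall k, k < n -> g k < N & forall k l, k < l < n -> c (g k) (g l) = a].
Proof.
have [N NP] := prehomogeneous T (#|T| * n).+1.
exists N => c.
have [|t [g [ts tn tg]]] := NP c (iota 0 N) (iota_uniq _ _); first by rewrite size_iota.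
have [a an] : exists a, n < size [seq x <- t | g x == a].
  by apply: pigeonhole; rewrite tn.
set u := [seq x <- t | g x == a] in an.
have ut : subseq u t by apply: filter_subseq.
have uN k : k < n -> nth 0 u k \in u by move=> kn; apply/mem_nth/ltn_trans/an.
have lt_in k l : k < l < n -> [/\ k < size u, l < size u & k < l].
  move=> /andP[kl ln]; have lu := ltn_trans ln an; split=> //.
  exact: ltn_trans kl lu.
exists (nth 0 u), a; split.
- move=> k l /lt_in[k1 l1 kl].
  have : pairwise ltn u.
    rewrite -sorted_pairwise; last exact: ltn_trans.
    by apply: (subseq_sorted ltn_trans _ (iota_ltn_sorted 0 N)); apply: subseq_trans ts.
  by move/(pairwiseP 0); apply.
- by move=> k /uN /(mem_subseq (subseq_trans ut ts)); rewrite mem_iota.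
- move=> k l /[dup] kln /lt_in[k1 l1 kl].
  have /(pairwiseP 0)/(_ k l k1 l1 kl) /eqP-> := subseq_pairwise ut tg.
  have : nth 0 u k \in u by apply: uN; lia.
  by rewrite mem_filter => /andP[/eqP].
Qed.

(** * Patterns *)

(* A pattern prescribes a graph on columns times rows: [later P i j] is the
   adjacency between column i of a row and column j of any later row, and
   [same P i j], read only for i < j, the adjacency inside a row.  A vertex is
   written (column, row). *)
Record pattern := Pattern {
  later : nat -> nat -> bool;
  same : nat -> nat -> bool }.

Definition same_row (P : pattern) (i j : nat) : bool :=
  if i < j then same P i j else if j < i then same P j i else false.

Definition padj (P : pattern) (u v : nat * nat) : bool :=
  if u.2 < v.2 then later P u.1 v.1
  else if v.2 < u.2 then later P v.1 u.1 else same_row P u.1 v.1.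

Lemma same_rowC P i j : same_row P i j = same_row P j i.
Proof. by rewrite /same_row; case: ltngtP. Qed.

Lemma same_rowxx P i : same_row P i i = false.
Proof. by rewrite /same_row ltnn. Qed.

Lemma padjC P u v : padj P u v = padj P v u.
Proof. by rewrite /padj same_rowC; case: ltngtP. Qed.

Lemma padjxx P u : padj P u u = false.
Proof. by rewrite /padj ltnn same_rowxx. Qed.

(** The map [f] need not be injective: where an embedding is needed, [hom_prime_inj] restores
    injectivity. *)
Definition array (G : fin_graph) (c N : nat) (P : pattern)
    (f : nat * nat -> fin_vertex G) : Prop :=
  forall u v, u.1 < c -> v.1 < c -> u.2 < N -> v.2 < N ->
    fin_adj (f u) (f v) = padj P u v.

Definition realized (C : graph_class) (c : nat) (P : pattern) : Prop :=
  forall N, exists G (f : nat * nat -> fin_vertex G),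
    [/\ C G, prime_graph G & array c N P f].

Lemma array_row (G : fin_graph) c N P (f : nat * nat -> fin_vertex G) i j k :
  array c N P f -> i < c -> j < c -> k < N ->
  fin_adj (f (i, k)) (f (j, k)) = same_row P i j.
Proof. by move=> arr ic jc kN; rewrite arr // /padj ltnn. Qed.

Lemma array_later (G : fin_graph) c N P (f : nat * nat -> fin_vertex G) i j k l :
  array c N P f -> i < c -> j < c -> k < l < N ->
  fin_adj (f (i, k)) (f (j, l)) = later P i j.
Proof.
move=> arr ic jc /andP[kl lN]; rewrite arr // /padj ?kl //=.
exact: ltn_trans lN.
Qed.

(** Ramsey's theorem for rows: a pair of rows is coloured by its adjacencies together with the label
    of its first row. The property [R] stands for whatever else the chosen rows have to retain, so
    it must pass to subsequences of rows. *)
Lemma uniformize (C : graph_class) (K : finType) (c : nat)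
    (R : forall G : fin_graph,
       (nat * nat -> fin_vertex G) -> (nat -> K) -> nat -> Prop) :
  (forall G f h (g : nat -> nat) N n, R G f h N ->
     (forall k l, k < l < n -> g k < g l) -> (forall k, k < n -> g k < N) ->
     R G (fun u => f (u.1, g u.2)) (fun k => h (g k)) n) ->
  (forall N, exists G f h, [/\ C G, prime_graph G & R G f h N]) ->
  exists P a, forall N, exists G f h, [/\ C G, prime_graph G, R G f h N,
    forall k, k < N -> h k = a & array c N P f].
Proof.
move=> Rsub ex.
pose T := ({ffun 'I_c * 'I_c -> bool * bool} * K)%type.
pose entry (t : T) i j : bool * bool :=
  if insub i is Some i' then if insub j is Some j' then t.1 (i', j')
  else (false, false) else (false, false).
pose pat (t : T) :=
  Pattern (fun i j => (entry t i j).1) (fun i j => (entry t i j).2).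
pose Q (t : T) N := exists G f h, [/\ C G, prime_graph G, R G f h N,
  forall k, k < N -> h k = t.2 & array c N (pat t) f].
suff [t tP] : exists t, forall N, Q t N by exists (pat t), t.2.
(* There are finitely many types [t]. If each one failed at some size [F t], the type of a
   homogeneous array of maximal size would succeed at its own [F t]. *)
apply: NNPP => none.
have /fin_all_exists[F FP] : forall t : T, exists n : nat, ~ Q t n.
  move=> t; apply: NNPP => all; apply: none; exists t => N.
  by apply: NNPP => nQ; apply: all; exists N.
pose N := \max_t F t.
(* One row more than needed, because the data inside a row are read off its colour with the next
   row. *)
have [M MP] := ramsey T N.+1.
have [G [f [h [CG pG RG]]]] := ex M.
have [g [t [gm gM gt]]] := MP (fun k l =>
  ([ffun p => (fin_adj (f (val p.1, k)) (f (val p.2, l)),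
               fin_adj (f (val p.1, k)) (f (val p.2, k)))], h k)).
apply: (FP t); have FN : F t <= N by apply: leq_bigmax.
have sub := Rsub _ _ _ g _ (F t) RG.
exists G, (fun u => f (u.1, g u.2)), (fun k => h (g k)); split=> //.
- apply: sub => [k l kl|k kF]; [apply: gm|apply: gM]; lia.
- by move=> k kF; rewrite -(gt k k.+1) //; lia.
have entE i j k l : i < c -> j < c -> k < l <= N ->
    entry t i j = (fin_adj (f (i, g k)) (f (j, g l)),
                   fin_adj (f (i, g k)) (f (j, g k))).
  by move=> ic jc kl; rewrite /entry !insubT /= -(gt k l) // ffunE.
move=> [i k] [j l] /= ic jc kF lF; rewrite /padj /=; case: ltngtP => [kl|lk|<-].
- by rewrite (entE _ _ k l) //; lia.
- by rewrite fin_adj_sym (entE _ _ l k) //; lia.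
rewrite /same_row; case: ltngtP => [ij|ji|->] /=; last exact: fin_adj_irrefl.
  by rewrite (entE _ _ k k.+1) //; lia.
by rewrite fin_adj_sym (entE _ _ k k.+1) //; lia.
Qed.

(* The two proper columns of a template are 0 and 1; the constant vertices are
   the vertices in row 0 of the columns 2, 3, ... *)
Record template := Template {
  l00 : bool; l01 : bool; l10 : bool; l11 : bool; q01 : bool;
  consts : seq (bool * bool); cc : bool }.

Definition fam_same (F : template) (i j : nat) : bool :=
  match i, j with
  | 0, 1 => q01 F
  | 0, j'.+2 => (nth (false, false) (consts F) j').1
  | 1, j'.+2 => (nth (false, false) (consts F) j').2
  | _, _ => cc F
  end.

Definition fam_later (F : template) (i j : nat) : bool :=
  match i, j with
  | 0, 0 => l00 F | 0, 1 => l01 F | 1, 0 => l10 F | 1, 1 => l11 F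
  | _, _ => if i < j then fam_same F i j else fam_same F j i
  end.

Coercion fam_pattern (F : template) : pattern :=
  Pattern (fam_later F) (fam_same F).

Definition valid (F : template) (u : nat * nat) : bool :=
  (u.1 < 2) || (u.1 < 2 + size (consts F)) && (u.2 == 0).

Lemma fam_const (F : template) u v : valid F u -> valid F v -> 1 < u.1 ->
  padj F u v = same_row F u.1 v.1.
Proof.
case: u v => [i k] [j l]; rewrite /valid /padj /same_row /= => vu vv i2.
have -> : k = 0 by lia.
case: (ltngtP i j) => [ij|ji|ij].
- have -> : l = 0 by lia.
  by [].
- rewrite ltn0; case: l vv => // l _ /=; rewrite /fam_later.
  case: i i2 ji vu => [|[|i]] // _ ji _.
  by case: j ji => [|[|j]] // ji; rewrite ltnNge ltnW.
- by have -> : l = 0 by lia.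
Qed.

(** Offsets send the two columns of one template row to different rows of the array, so that [q01]
    may be matched by an adjacency between rows as well as by one inside a row. *)
Record placement := Placement {
  col : nat -> nat; off : nat -> nat; spot : nat -> nat * nat }.

(* The row of a constant vertex in a placement is 0 or 1, for a first or a last
   row of the array; row k of column i < 2 goes to row 2 k + off i + 1. *)
Definition place (p : placement) (n : nat) (u : nat * nat) : nat * nat :=
  if u.1 < 2 then (col p u.1, (u.2.*2 + off p u.1).+1)
  else ((spot p u.1).1, (spot p u.1).2 * n.*2.+1).

(** Rows matter through their order only: in the tests of a proper column against a constant, row 1
    stands for any inner row, and rows 0 and 2 for the first and the last one. *)
Definition fits (p : placement) (F : template) (P : pattern) : bool :=
  let ks := iota 2 (size (consts F)) in
  [&& off p 0 <= 1, off p 1 <= 1,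
      all (fun k => (spot p k).2 <= 1) ks,
      l00 F == later P (col p 0) (col p 0),
      l01 F == later P (col p 0) (col p 1),
      l10 F == later P (col p 1) (col p 0),
      l11 F == later P (col p 1) (col p 1),
      q01 F == padj P (col p 0, off p 0) (col p 1, off p 1),
      all (fun k => fam_same F 0 k ==
        padj P (col p 0, 1) ((spot p k).1, (spot p k).2.*2)) ks,
      all (fun k => fam_same F 1 k ==
        padj P (col p 1, 1) ((spot p k).1, (spot p k).2.*2)) ks &
      all (fun k => all (fun k' => (k < k') ==>
        (fam_same F k k' == padj P (spot p k) (spot p k'))) ks) ks].

Lemma padj_rows P i j k l k' l' :
  (k < l) = (k' < l') -> (l < k) = (l' < k') ->
  padj P (i, k) (j, l) = padj P (i, k') (j, l').
Proof. by rewrite /padj /= => -> ->. Qed.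

Lemma valid_const F u : valid F u -> 1 < u.1 ->
  u.1 \in iota 2 (size (consts F)).
Proof. rewrite /valid mem_iota; lia. Qed.

Lemma padj_spot P i j k o s n : o <= 1 -> s <= 1 -> k < n ->
  padj P (i, (k.*2 + o).+1) (j, s * n.*2.+1) = padj P (i, 1) (j, s.*2).
Proof. by move=> o1 s1 kn; apply: padj_rows; case: s s1 => [|[|]] //; lia. Qed.

Lemma padj_spots P i j s t n : s <= 1 -> t <= 1 ->
  padj P (i, s * n.*2.+1) (j, t * n.*2.+1) = padj P (i, s) (j, t).
Proof.
by move=> s1 t1; apply: padj_rows; case: s s1 => [|[|]] // _;
  case: t t1 => [|[|]] //; lia.
Qed.

Lemma padj_cols P i j k l o o' : o <= 1 -> o' <= 1 ->
  padj P (i, (k.*2 + o).+1) (j, (l.*2 + o').+1) =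
  if k < l then later P i j else if l < k then later P j i
  else padj P (i, o) (j, o').
Proof.
move=> o1 o1'; case: ltngtP => kl.
- rewrite /padj /=; suff -> : (k.*2 + o).+1 < (l.*2 + o').+1 by []; lia.
- rewrite padjC /padj /=.
  suff -> : (l.*2 + o').+1 < (k.*2 + o).+1 by []; lia.
- by apply: padj_rows; lia.
Qed.

Lemma fits_padj p F P n u v : fits p F P ->
  valid F u -> valid F v -> u.2 < n -> v.2 < n ->
  padj P (place p n u) (place p n v) = padj F u v.
Proof.
case/and5P=> o0 o1 /allP os /eqP L00 /and5P[/eqP L01 /eqP L10 /eqP L11 /eqP Q].
case/and3P=> /allP K0 /allP K1 /allP KK.
wlog le : u v / u.1 <= v.1.
  move=> wl vu vv un vn; case: (leqP u.1 v.1) => le; first exact: wl.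
  by rewrite padjC [RHS]padjC; apply: wl => //; apply: ltnW.
have oE x : x < 2 -> off p x <= 1 by case: x => [|[|]].
case: (ltnP v.1 2) => v2; last first.
  move=> vu vv un vn; rewrite [RHS]padjC fam_const //.
  have vk := valid_const vv v2; have /= ov := os _ vk.
  rewrite [place p n v]/place ltnNge v2 /=.
  case: (ltnP u.1 2) => u2.
    rewrite /place u2 padj_spot ?oE // same_rowC /same_row (leq_trans u2 v2).
    by case: (u.1) u2 => [|[|]] // _ /=; rewrite -?(eqP (K0 _ vk)) -?(eqP (K1 _ vk)).
  have uk := valid_const vu u2; have /= ou := os _ uk.
  rewrite [place p n u]/place ltnNge u2 /= padj_spots //.
  move: le; rewrite leq_eqVlt => /predU1P[->|lt]; first by rewrite padjxx same_rowxx.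
  rewrite same_rowC /same_row lt /=.
  have /allP/(_ _ vk)/implyP/(_ lt)/eqP-> := KK _ uk.
  by case: (spot p u.1) (spot p v.1).
have u2 : u.1 < 2 by apply: leq_ltn_trans v2.
move=> _ _ _ _; rewrite /place u2 v2.
case: u v u2 v2 le => [i k] [j l] /= i2 j2 ij.
have LE x y : x < 2 -> y < 2 -> later P (col p x) (col p y) = fam_later F x y.
  by case: x => [|[|]] //; case: y => [|[|]].
rewrite padj_cols ?oE // [RHS]/padj /= !LE //.
case: ltngtP => // _.
by case: i j i2 j2 ij => [|[|]] // [|[|]] // _ _ _; rewrite padjxx.
Qed.

(** * Ages of templates are minimal prime *)

Definition famAge (F : template) : graph_class := fun H =>
  exists h : fin_vertex H -> nat * nat,
    [/\ injective h, forall x, valid F (h x) &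
        forall x y, fin_adj x y = padj F (h x) (h y)].

Lemma famAge_hereditary F : hereditary (famAge F).
Proof.
move=> G H /embedsP[f [fI fA]] [h [hI hV hA]].
exists (fun x => h (f x)); split=> [x y /hI/fI //|x|x y]; first exact: hV.
by rewrite -hA -[LHS]fA.
Qed.

(** * Finite truncations of a template *)

Section Truncation.

Variables (F : template) (n : nat).

Definition trunc_vertex : finType :=
  {u : 'I_(size (consts F)).+2 * 'I_n | valid F (val u.1, val u.2)}.

Definition trunc_pos (x : trunc_vertex) : nat * nat :=
  (nat_of_ord (val x).1, nat_of_ord (val x).2).

Lemma trunc_pos_inj : injective trunc_pos.
Proof.
by case=> [[i k] v] [[j l] w] [/val_inj ij /val_inj kl]; apply: val_inj; rewrite /= ij kl.
Qed.

Definition trunc_adj : rel trunc_vertex :=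
  fun x y => padj F (trunc_pos x) (trunc_pos y).

Lemma trunc_adj_sym : symmetric trunc_adj.
Proof. by move=> x y; rewrite /trunc_adj padjC. Qed.

Lemma trunc_adj_irrefl : irreflexive trunc_adj.
Proof. by move=> x; rewrite /trunc_adj padjxx. Qed.

Definition trunc : fin_graph := FinGraph trunc_adj_sym trunc_adj_irrefl.

Lemma trunc_posP (x : trunc_vertex) : valid F (trunc_pos x) && ((trunc_pos x).2 < n).
Proof. by case: x => [[i k] /= ->] /=; rewrite ltn_ord. Qed.

Lemma trunc_onto u : valid F u -> u.2 < n -> exists x, trunc_pos x = u.
Proof.
case: u => i k vu kn; have i2 : i < (size (consts F)).+2 by move: vu;
  rewrite /valid /=; lia.
by exists (exist _ (Ordinal i2, Ordinal kn) vu).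
Qed.

Lemma famAge_trunc : famAge F trunc.
Proof.
by exists trunc_pos; split=> // [|x]; [exact: trunc_pos_inj|case/andP: (trunc_posP x)].
Qed.

Lemma trunc_card : n <= #|trunc_vertex|.
Proof.
have onto (k : 'I_n) : exists x, trunc_pos x == (0, val k).
  have [x <-] := @trunc_onto (0, val k) isT (ltn_ord k); by exists x.
have /leq_card : injective (fun k => xchoose (onto k)).
  move=> k l E; have := eqP (xchooseP (onto k)).
  by rewrite E (eqP (xchooseP (onto l))) => -[/val_inj].
by rewrite card_ord.
Qed.

End Truncation.

Definition rows3 (F : template) : seq (nat * nat) :=
  [seq u <- [seq (i, k) | i <- iota 0 (size (consts F)).+2, k <- iota 0 3] | valid F u].

Definition absorb (F : template) (s : seq (nat * nat)) : seq (nat * nat) :=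
  [seq z <- rows3 F | (z \in s) || (has (padj F z) s && ~~ all (padj F z) s)].

(** With at most two constants there are at most 8 vertices, so 7 rounds certainly close up a pair.
    For soundness the number of rounds is irrelevant. *)
Definition prime3 (F : template) : bool :=
  all (fun x => all (fun y => (x == y) ||
    all (fun z => z \in iter 7 (absorb F) [:: x; y]) (rows3 F)) (rows3 F)) (rows3 F).

Lemma mem_rows3 F (u : nat * nat) : (u \in rows3 F) = valid F u && (u.2 < 3).
Proof.
rewrite mem_filter; case vu : (valid F u); rewrite ?andTb ?andFb //.
apply/allpairsPdep/idP => [[i [k [_ k3 ->]]]|u3].
  by move: k3; rewrite mem_iota.
exists u.1, u.2; rewrite !mem_iota; split; [|lia|by case: u {vu u3}].
by move: vu; rewrite /valid; lia.
Qed.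

Lemma prime3_closed F (A : pred (nat * nat)) (x y z : nat * nat) : prime3 F ->
  (forall z, z \in rows3 F -> ~~ A z ->
     (forall u, u \in rows3 F -> A u -> padj F z u) \/
     (forall u, u \in rows3 F -> A u -> ~~ padj F z u)) ->
  x \in rows3 F -> y \in rows3 F -> z \in rows3 F ->
  x != y -> A x -> A y -> A z.
Proof.
move=> /allP p3 mod xr yr zr xy Ax Ay.
have /allP/(_ _ yr) := p3 _ xr; rewrite (negbTE xy) orFb => /allP/(_ _ zr).
move: 7 => m; suff sub u : u \in iter m (absorb F) [:: x; y] -> (u \in rows3 F) && A u.
  by move=> /sub/andP[].
elim: m u => [|m IH] u; first by rewrite [iter _ _ _]/= in_cons mem_seq1 =>
  /orP[] /eqP->; rewrite ?xr ?Ax ?yr ?Ay.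
rewrite iterS {1}/absorb mem_filter => /andP[/orP[/IH //|mix] ur].
rewrite ur /=; apply/negPn/negP => /(mod _ ur).
case/andP: mix => /hasP[v /IH/andP[vr Av] uv] /allPn[w /IH/andP[wr Aw] uw].
by case=> uA; [move: uw; rewrite uA|have := uA _ vr Av; rewrite uv].
Qed.

Lemma three_rows p q r n : p < n -> q < n -> r < n -> 2 < n ->
  exists g : nat -> nat, [/\ forall k l, k < l < 3 -> g k < g l < n,
    exists2 k, k < 3 & g k = p, exists2 k, k < 3 & g k = q &
    exists2 k, k < 3 & g k = r].
Proof.
move=> pn qn rn n2.
have sorted p' q' r' : p' <= q' <= r' -> r' < n ->
  exists a b c, [/\ a < b < c, c < n &
    [/\ p' \in [:: a; b; c], q' \in [:: a; b; c] & r' \in [:: a; b; c]]].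
  move=> le rn'; have [pq|pq] := eqVneq p' q'; have [qr|qr] := eqVneq q' r'.
  - subst q' r'; case: (ltnP p'.+2 n) => ?; last first.
      case: (ltnP p'.+1 n) => ?.
        by exists p'.-1, p', p'.+1; rewrite !inE !eqxx !orbT; split=> //; lia.
      by exists p'.-2, p'.-1, p'; rewrite !inE !eqxx !orbT; split=> //; lia.
    by exists p', p'.+1, p'.+2; rewrite !inE !eqxx; split=> //; lia.
  - subst q'; case: (ltnP p'.+1 r') => ?.
      by exists p', p'.+1, r'; rewrite !inE !eqxx !orbT; split=> //; lia.
    case: (ltnP r'.+1 n) => ?.
      by exists p', r', r'.+1; rewrite !inE !eqxx !orbT; split=> //; lia.
    by exists p'.-1, p', r'; rewrite !inE !eqxx !orbT; split=> //; lia.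
  - subst r'; case: (ltnP p'.+1 q') => ?.
      by exists p', p'.+1, q'; rewrite !inE !eqxx !orbT; split=> //; lia.
    case: (ltnP q'.+1 n) => ?.
      by exists p', q', q'.+1; rewrite !inE !eqxx !orbT; split=> //; lia.
    by exists p'.-1, p', q'; rewrite !inE !eqxx !orbT; split=> //; lia.
  - by exists p', q', r'; rewrite !inE !eqxx !orbT; split=> //; lia.
have [a [b [c [abc cn [pm qm rm]]]]] : exists a b c, [/\ a < b < c, c < n &
    [/\ p \in [:: a; b; c], q \in [:: a; b; c] & r \in [:: a; b; c]]].
  have [pq|qp] := leqP p q; have [qr|rq] := leqP q r; have [pr|rp] := leqP p r.
  - by apply: sorted; rewrite ?pq.
  - by apply: sorted; rewrite ?pq.
  - have [] := sorted p r q; [by rewrite pr ltnW|by []|].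
    by move=> a [b [c [? ? []]]]; exists a, b, c.
  - have [] := sorted r p q; [by rewrite pq ltnW|by []|].
    by move=> a [b [c [? ? []]]]; exists a, b, c.
  - have [] := sorted q p r; [by rewrite pr ltnW|by []|].
    by move=> a [b [c [? ? []]]]; exists a, b, c.
  - have [] := sorted q r p; [by rewrite qr ltnW|by []|].
    by move=> a [b [c [? ? []]]]; exists a, b, c.
  - by move: (leq_trans pr (ltnW rq)); rewrite leqNgt qp.
  - have [] := sorted r q p; [by rewrite (ltnW rq) (ltnW qp)|by []|].
    by move=> a [b [c [? ? []]]]; exists a, b, c.
exists (nth 0 [:: a; b; c]); split.
- by clear pm qm rm; move=> [|[|[|k]]] [|[|[|l]]] //=; lia.
- by exists (index p [:: a; b; c]); rewrite ?index_mem ?nth_index.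
- by exists (index q [:: a; b; c]); rewrite ?index_mem ?nth_index.
- by exists (index r [:: a; b; c]); rewrite ?index_mem ?nth_index.
Qed.

(* Any three vertices of a truncation lie in a copy of the three-row one. *)
Lemma trunc_prime F n : prime3 F -> 2 < n -> prime_graph (trunc F n).
Proof.
move=> p3 n2 A mod.
case: (boolP [exists x in A, exists y in A, x != y]) => [|none]; last first.
  have [->|/set0Pn[x xA]] := eqVneq A set0; first by constructor 1.
  constructor 2; exists x; apply/setP => y; rewrite inE.
  apply/idP/eqP => [yA|-> //]; apply/eqP/negPn/negP => ne; case/negP: none.
  by apply/exists_inP; exists y => //; apply/exists_inP; exists x.
move=> /exists_inP[x xA /exists_inP[y yA xy]]; constructor 3.
apply/setP => z; rewrite [RHS]inE.
have /andP[xv xn] := trunc_posP x; have /andP[yv yn] := trunc_posP y.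
have /andP[zv zn] := trunc_posP z.
have [g [gm gx gy gz]] := three_rows xn yn zn n2.
have gn k : k < 3 -> g k < n.
  case: k => [|[|[|k]]] // _; [have := gm 0 1 isT|have := gm 1 2 isT|have := gm 1 2
    isT]; lia.
pose phi u := if u.1 < 2 then (u.1, g u.2) else u : nat * nat.
have phiV u : valid F u -> valid F (phi u) by rewrite /phi; case: ifP => // u2 _;
  rewrite /valid u2.
have phi1 u : (phi u).1 = u.1 by rewrite /phi; case: ifP.
have phiN u : valid F u -> u.2 < 3 -> (phi u).2 < n.
  by rewrite /phi; case: ifP => u2 vu u3 /=; [exact: gn|lia].
have phiA u v : valid F u -> valid F v -> u.2 < 3 -> v.2 < 3 ->
    padj F (phi u) (phi v) = padj F u v.
  move=> uv vv u3 v3; case: (ltnP 1 u.1) => u2.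
    by rewrite !fam_const ?phi1 //; apply: phiV.
  case: (ltnP 1 v.1) => v2.
    by rewrite padjC [RHS]padjC !fam_const ?phi1 //; apply: phiV.
  rewrite /phi !ltnS u2 v2; case: u v u3 v3 {u2 v2 uv vv} => [i k] [j l] /= k3 l3.
  apply: padj_rows; case: (ltngtP k l) => [kl|lk|->]; rewrite ?ltnn //.
    - by have /andP[-> _] := gm k l (introT andP (conj kl l3)).
    - have /andP[lt _] := gm l k (introT andP (conj lk k3)).
      by apply/negbTE; rewrite -leqNgt ltnW.
    - have /andP[lt _] := gm k l (introT andP (conj kl l3)).
      by apply/negbTE; rewrite -leqNgt ltnW.
    - by have /andP[-> _] := gm l k (introT andP (conj lk k3)).
have lift (w : fin_vertex (trunc F n)) : valid F (trunc_pos w) -> (exists2 k,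
  k < 3 & g k = (trunc_pos w).2) ->
    exists2 u, u \in rows3 F & phi u = trunc_pos w.
  move=> wv [k k3 gk]; case: (ltnP (trunc_pos w).1 2) => w2.
    exists ((trunc_pos w).1, k); first by rewrite mem_rows3 /valid w2.
    by rewrite /phi w2 gk; case: trunc_pos.
  exists (trunc_pos w); last by rewrite /phi ltnNge w2.
  by rewrite mem_rows3 wv; move: wv; rewrite /valid; lia.
have [x' xr Ex] := lift x xv gx; have [y' yr Ey] := lift y yv gy.
have [z' zr Ez] := lift z zv gz.
pose A' u := [exists a in A, trunc_pos a == phi u].
have A'E (w : fin_vertex (trunc F n)) u : phi u = trunc_pos w -> A' u = (w \in A).
  move=> uw; apply/exists_inP/idP => [[a aA /eqP]|wA]; last by exists w; rewrite ?uw.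
  by rewrite uw => /trunc_pos_inj <-.
have {}lift u : u \in rows3 F -> exists w : fin_vertex (trunc F n), phi u = trunc_pos w.
  rewrite mem_rows3 => /andP[uv u3].
  by have [w] := trunc_onto (phiV u uv) (phiN u uv u3); exists w.
rewrite -(A'E z z' Ez) //; apply: (@prime3_closed F A' x' y' z') => //.
- move=> u ur; have [w uw] := lift u ur; rewrite (A'E w) // => /mod.
  have uvw v a : v \in rows3 F -> phi v = trunc_pos a ->
    padj F u v = fin_adj (w : fin_vertex (trunc F n)) a.
    rewrite mem_rows3 => /andP[vv v3] va; move: ur; rewrite mem_rows3 => /andP[uv u3].
    by rewrite -phiA // uw va.
  case=> all; [left|right] => v vr; have [a va] := lift v vr;
    by rewrite (A'E a) // (uvw v a) // => /all.
- by apply: contra xy => /eqP E; rewrite -(inj_eq (@trunc_pos_inj F n)) -Ex E Ey.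
- by rewrite (A'E x).
- by rewrite (A'E y).
Qed.

(** Preserving adjacency on enough rows is sufficient: the truncation to these rows is prime as soon
    as there are three of them, so the map is injective on it. *)
Lemma famAge_transfer F H : prime3 F -> famAge F H ->
  exists n, forall (G : fin_graph) (f : nat * nat -> fin_vertex G),
    (forall u v, valid F u -> valid F v -> u.2 < n -> v.2 < n ->
       fin_adj (f u) (f v) = padj F u v) ->
    emb H G.
Proof.
move=> p3 [h [hI hV hA]].
pose n := maxn 3 (\max_x (h x).2).+1.
have hn x : (h x).2 < n.
  apply: leq_trans (leq_maxr _ _); rewrite ltnS.
  exact: (@leq_bigmax _ (fun x => (h x).2)).
exists n => G f fA.
have n2 : 2 < n by apply: leq_maxl.
have pT := trunc_prime p3 n2.
pose e (t : fin_vertex (trunc F n)) : G := f (trunc_pos t).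
have eA x y : adj (e x) (e y) = fin_adj x y.
  by case/andP: (trunc_posP x) => ? ?; case/andP: (trunc_posP y) => ? ?; apply: fA.
have eI := hom_prime_inj pT (leq_trans n2 (trunc_card F n)) eA.
have onto x : exists t : fin_vertex (trunc F n), trunc_pos t == h x.
  by have [t <-] := trunc_onto (hV x) (hn x); exists t.
have posE x := eqP (xchooseP (onto x)).
exists (fun x => e (xchoose (onto x))); split=> [x y /eI E|x y].
  by apply: hI; rewrite -!posE E.
by rewrite [LHS]fA ?posE // -hA.
Qed.

Lemma famAge_unbounded F : prime3 F ->
  forall N, exists G, [/\ famAge F G, prime_graph G & N <= #|fin_vertex G|].
Proof.
move=> p3 N; exists (trunc F (maxn 3 N)); split; first exact: famAge_trunc.
  exact: trunc_prime (leq_maxl _ _).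
exact: leq_trans (leq_maxr _ _) (trunc_card _ _).
Qed.

Lemma nat_choice (T : Type) (t0 : T) (P : nat -> T -> Prop) n :
  (forall k, k < n -> exists x, P k x) ->
  exists f, forall k, k < n -> P k (f k).
Proof.
elim: n => [|n IH] ex; first by exists (fun=> t0).
have [k kn|f fP] := IH; first by apply: ex; apply: ltnW.
have [x Px] := ex n (ltnSn n).
exists (fun k => if k == n then x else f k) => k.
by rewrite ltnS leq_eqVlt; case: eqP => [-> _|_ /=] //; apply: fP.
Qed.

(* If the constant vertex c of the template is missing, then the vertices
   beyond some row, together with the constant vertices in E, form a module. *)
Definition tail_module (F : template) (c : nat) (E : seq nat) : bool :=
  all (fun d => (fam_later F d 0 == fam_later F d 1) &&
    all (fun e => same_row F d e == fam_later F d 0) E) [:: 0; 1] &&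
  all (fun j => (j == c) || (j \in E) || (same_row F j 0 == same_row F j 1) &&
    all (fun e => same_row F j e == same_row F j 0) E)
    (iota 2 (size (consts F))).

(** A nonempty [E] occurs for the vertex x of [template_F]: when x is missing, the tail has to be
    taken with the vertex a_oo, which sees the earlier rows as every later a does. *)
Definition essential (F : template) (c : nat) : bool :=
  has (fun E => (c \notin E) && tail_module F c E)
    ([::] :: [seq [:: e] | e <- iota 2 (size (consts F))]).

(** * Large prime graphs in the age of a template *)

Section LargePrime.

Variables (F : template) (G : fin_graph).
Notation V := (fin_vertex G).
Variable h : V -> nat * nat.
Hypotheses (pG : prime_graph G) (hI : injective h).
Hypothesis hV : forall x, valid F (h x).
Hypothesis hA : forall x y, fin_adj x y = padj F (h x) (h y).

Definition column_rows (d : nat) : seq nat :=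
  sort leq [seq (h x).2 | x <- enum V & (h x).1 == d].

Lemma column_rowsP d k : reflect (exists x, h x = (d, k)) (k \in column_rows d).
Proof.
rewrite mem_sort; apply: (iffP mapP) => [[x]|[x hx]].
  by rewrite mem_filter => /andP[/eqP <- _] ->; exists x; rewrite -surjective_pairing.
exists x; last by rewrite hx.
by rewrite mem_filter hx eqxx mem_enum.
Qed.

Lemma column_rows_sorted d : sorted ltn (column_rows d).
Proof.
rewrite ltn_sorted_uniq_leq sort_sorted ?andbT ?sort_uniq; last exact: leq_total.
have := enum_uniq V; move: (enum V) => s us.
rewrite map_inj_in_uniq ?filter_uniq // => x y.
rewrite !mem_filter => /andP[/eqP dx _] /andP[/eqP dy _] exy; apply: hI.
by case: (h x) (h y) dx dy exy => [i k] [j l] /= -> -> ->.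
Qed.

Lemma column_rows_lt d i j : i < j < size (column_rows d) ->
  nth 0 (column_rows d) i < nth 0 (column_rows d) j.
Proof.
case/andP=> ij jd; apply: (sorted_ltn_nth ltn_trans 0 (column_rows_sorted d)) => //.
exact: ltn_trans jd.
Qed.

Lemma nth_column_rows d i : i < size (column_rows d) ->
  exists x, h x = (d, nth 0 (column_rows d) i).
Proof. by move=> id; apply/column_rowsP/mem_nth. Qed.

Lemma card_columns :
  #|V| <= size (column_rows 0) + size (column_rows 1) + size (consts F).
Proof.
rewrite !size_sort !size_map cardE.
have := enum_uniq V; move: (enum V) => s us.
rewrite !size_filter -(count_predC (fun x => (h x).1 == 0) s) -addnA leq_add2l.
rewrite -size_filter -(count_predC (fun x => (h x).1 == 1)).
apply: leq_add; first by rewrite count_filter; apply: sub_count => x /= /andP[].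
rewrite count_filter -size_filter; set t := filter _ _.
suff sub : {subset [seq h x | x <- t] <= [seq (j, 0) | j <- iota 2 (size (consts F))]}.
  have ut : uniq [seq h x | x <- t] by rewrite map_inj_uniq // filter_uniq.
  by have := uniq_leq_size ut sub; rewrite !size_map size_iota.
move=> u /mapP[x]; rewrite mem_filter => /andP[/= /andP[x1 x0] _] ->.
apply/mapP; exists (h x).1.
  by apply: (valid_const (hV x)); case: (h x).1 x0 x1 => [|[|]].
move: (hV x); rewrite /valid; case: (h x) x0 x1 => [[|[|i]] k] //= _ _.
by move=> /andP[_ /eqP->].
Qed.

(** Otherwise the tail that starts at the second occupied row of column [d] is a module; it contains
    the second and third vertices of the column but not the first. *)
Lemma const_present c d : essential F c -> 1 < c < 2 + size (consts F) -> d < 2 ->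
  2 < size (column_rows d) -> exists x, h x = (c, 0).
Proof.
move=> /hasP[E _ /andP[cE /andP[/allP cols /allP csts]]] cF d2 d3.
apply: NNPP => none.
have [x0 h0] : exists x, h x = (d,
  nth 0 (column_rows d) 0) by apply: nth_column_rows; lia.
have [x1 h1] : exists x, h x = (d,
  nth 0 (column_rows d) 1) by apply: nth_column_rows; lia.
have [x2 h2] : exists x, h x = (d,
  nth 0 (column_rows d) 2) by apply: nth_column_rows; lia.
have lt01 : nth 0 (column_rows d) 0 < nth 0 (column_rows d) 1 by apply:
  column_rows_lt; lia.
have lt12 : nth 0 (column_rows d) 1 < nth 0 (column_rows d) 2 by apply:
  column_rows_lt; lia.
set r := nth 0 (column_rows d) 1 in h1 lt01 lt12.
pose A := [set x | ((h x).1 < 2) && (r <= (h x).2) || ((h x).1 > 1) && ((h x).1 \in E)].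
have mod : is_module A.
  move=> x; rewrite inE => xA.
  suff [b bP] : exists b, forall y, y \in A -> fin_adj x y = b.
    by case: b bP => bP; [left|right] => y /bP ->.
  case: (ltnP (h x).1 2) => x2'.
    exists (fam_later F (h x).1 0).
    have xin : (h x).1 \in [:: 0; 1] by case: (h x).1 x2' => [|[|]].
    have /andP[/eqP later01 /allP laterE] := cols _ xin.
    move=> y; rewrite inE hA => /orP[/andP[y2 ry]|/andP[y2 yE]].
      have lt : (h x).2 < (h y).2.
        by apply: leq_trans ry; move: xA; rewrite x2' /= negb_or -ltnNge => /andP[].
      rewrite /padj lt; case: (h y).1 y2 => [|[|]] // _; by rewrite -later01.
    by rewrite padjC fam_const // same_rowC (eqP (laterE _ yE)).
  have xc := valid_const (hV x) x2'.
  exists (same_row F (h x).1 0) => y; rewrite inE hA => yA.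
  rewrite fam_const //; have := csts _ xc.
  have /negbTE-> : (h x).1 != c.
    apply/eqP => xc'; apply: none; exists x; move: (hV x); rewrite /valid ltnNge x2' /=.
    by case: (h x) xc' => i k /= -> /andP[_ /eqP->].
  have /negbTE-> : (h x).1 \notin E by move: xA; rewrite x2' /= negb_or => /andP[].
  case/andP=> /eqP same01 /allP sameE; case/orP: yA => /andP[y2 yE].
    by case: (h y).1 y2 => [|[|]].
  exact/eqP/sameE.
have x1A : x1 \in A by rewrite inE h1 /= d2 leqnn.
have x2A : x2 \in A by rewrite inE h2 /= d2 ltnW.
have := prime_module pG mod x1A x2A; have -> : x1 != x2.
  by apply/eqP => E12; move: lt12; rewrite /r; move: h1; rewrite E12 h2 /r => -[->];
    rewrite ltnn.
move=> /(_ isT) AT; have : x0 \in A by rewrite AT inE.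
by rewrite inE h0 /= d2 leqNgt lt01 ltnNge -ltnS d2.
Qed.

(** Two successive vertices of column [d] yield one row of the template: a vertex separating them
    lies in the other column, in a row between theirs, and its adjacency to one of the two is [q01].
    Distinct values of [k] use disjoint blocks of rows, so the order of rows is kept. *)
Lemma column_pair d k : d < 2 -> 2 < #|V| -> k.*2.+1 < size (column_rows d) ->
  exists xz : V * V, exists i j,
    [/\ h xz.1 = (d, i), h xz.2 = (1 - d, j), fin_adj xz.1 xz.2 = q01 F,
        nth 0 (column_rows d) k.*2 <= i <= nth 0 (column_rows d) k.*2.+1 &
        nth 0 (column_rows d) k.*2 <= j <= nth 0 (column_rows d) k.*2.+1].
Proof.
move=> d2 lt2 kd.
have [x hx] := nth_column_rows (ltnW kd); have [y hy] := nth_column_rows kd.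
have lt : nth 0 (column_rows d) k.*2 < nth 0 (column_rows d) k.*2.+1.
  by apply: column_rows_lt; rewrite ltnSn.
move: (nth 0 _ k.*2) (nth 0 _ k.*2.+1) hx hy lt => r s hx hy rs.
have xy : x != y by apply/eqP => E; move: hx hy; rewrite E => -> [E'];
  rewrite E' ltnn in rs.
have [z [zx zy]] := prime_distinguish pG xy lt2; rewrite !hA hx hy => zxy.
(* A constant sees a whole column alike, and a vertex of column [d] sees all the other vertices of
   that column alike. *)
have [j hz] : exists j, h z = (1 - d, j).
  move: zxy; case: (ltnP (h z).1 2) => z2; last first.
    by rewrite !fam_const // ?eqxx // -?hx -?hy.
  case: (eqVneq (h z).1 d) => [zd|zd _]; last first.
    exists (h z).2; case: (h z) z2 zd => [i k'] /= i2 id; congr pair.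
    by case: i d {hx hy kd} i2 d2 id => [|[|]] // [|[|]].
  have zr : (h z).2 != r.
    apply: contra zx => /eqP zr; apply/eqP/hI;
      by rewrite hx [LHS]surjective_pairing zd zr.
  have zs : (h z).2 != s.
    apply: contra zy => /eqP zs; apply/eqP/hI;
      by rewrite hy [LHS]surjective_pairing zd zs.
  by rewrite /padj zd /=; case: ltngtP zr => // _ _; case: ltngtP zs => // _ _;
    rewrite eqxx.
have [rj js] : r <= j /\ j <= s.
  move: zxy; rewrite hz /padj /=; case: (ltngtP j r) => jr; last by rewrite jr (ltnW rs).
    by rewrite (ltn_trans jr rs) eqxx.
  move=> ne; split=> //.
  by move: ne; case: (ltngtP j s) => // _; rewrite eqxx.
have [zxq|zxq] := eqVneq (fin_adj z x) (q01 F).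
  by exists (x, z), r, j; rewrite fin_adj_sym rj js leqnn ltnW.
exists (y, z), s, j; rewrite fin_adj_sym rj js leqnn (ltnW rs); split=> //=.
move: zxy zxq; rewrite !hA hx hy.
by case: padj; case: padj; case: q01.
Qed.

Lemma large_template n d : d < 2 -> all (essential F) (iota 2 (size (consts F))) ->
  2 < #|V| -> n.*2.+2 < size (column_rows d) ->
  exists f : nat * nat -> V, forall u v, valid F u -> valid F v ->
    u.2 < n -> v.2 < n -> fin_adj (f u) (f v) = padj F u v.
Proof.
move=> d2 /allP ess lt2 nd.
have other i : i < 2 -> i != d -> 1 - d = i by lia.
have [x0 _] := nth_column_rows (ltn_trans (ltn0Sn _) nd).
have /(nat_choice x0)[c cP] : forall i, i < 2 + size (consts F) ->
    exists x : V, 1 < i -> h x = (i, 0).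
  move=> i iF; case: (ltnP 1 i) => i1; last by exists x0.
  have [|||x hx] := @const_present i d _ _ d2; first by apply: ess; rewrite mem_iota i1.
  - by rewrite i1.
  - by apply: leq_ltn_trans nd.
  - by exists x.
have /(nat_choice (x0, x0))[W WP] : forall k, k < n -> exists xz : V * V, exists i j,
    [/\ h xz.1 = (d, i), h xz.2 = (1 - d, j), fin_adj xz.1 xz.2 = q01 F,
        nth 0 (column_rows d) k.*2 <= i <= nth 0 (column_rows d) k.*2.+1 &
        nth 0 (column_rows d) k.*2 <= j <= nth 0 (column_rows d) k.*2.+1].
  move=> k kn; apply: column_pair => //.
  by apply: leq_trans nd; rewrite !ltnS; lia.
pose f u := if u.1 < 2 then (if u.1 == d then (W u.2).1 else (W u.2).2) else c u.1 : V.
have f1 u : valid F u -> u.2 < n -> (h (f u)).1 = u.1.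
  move=> vu un; rewrite /f; case: (ltnP u.1 2) => u2.
    have [i [j [hi hj _ _ _]]] := WP _ un.
    by case: eqP => [->|/eqP ud]; rewrite ?hi ?hj //=; apply: other.
  by rewrite cP //; move: vu; rewrite /valid ltnNge u2 => /andP[].
have fr u : u.1 < 2 -> u.2 < n ->
    nth 0 (column_rows d) u.2.*2 <= (h (f u)).2 <= nth 0 (column_rows d) u.2.*2.+1.
  move=> u2 un; rewrite /f u2; have [i [j [hi hj _ ir jr]]] := WP _ un.
  by case: eqP => _; rewrite ?hi ?hj.
have flt u v : u.1 < 2 -> v.1 < 2 -> u.2 < v.2 < n -> (h (f u)).2 < (h (f v)).2.
  move=> u2 v2 /andP[uv vn]; have /andP[_ le] := fr u u2 (ltn_trans uv vn).
  have /andP[ge _] := fr v v2 vn; apply: leq_ltn_trans le (leq_trans _ ge).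
  by apply: column_rows_lt; lia.
exists f => u v vu vv un vn; rewrite hA.
case: (ltnP 1 u.1) => u2; first by rewrite !fam_const ?f1.
case: (ltnP 1 v.1) => v2; first by rewrite padjC [RHS]padjC !fam_const ?f1.
case: (ltngtP u.2 v.2) => uv.
- by rewrite /padj flt ?uv // !f1.
- by rewrite padjC [RHS]padjC /padj flt ?uv // !f1.
case: (eqVneq u.1 v.1) => uv1.
  have -> : u = v by case: u v uv uv1 {vu vv un vn u2 v2} => ? ? [? ?] /= -> ->.
  by rewrite !padjxx.
rewrite -hA /f !ltnS u2 v2 uv; have [i [j [hi hj Wq _ _]]] := WP _ vn.
have Q : padj F u v = q01 F.
  rewrite /padj uv ltnn /same_row.
  by case: (u.1) (v.1) u2 v2 uv1 => [|[|]] // [|[|]].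
rewrite {}Q -Wq.
case: eqP => ud; case: eqP => vd //; first by rewrite ud vd eqxx in uv1.
  by rewrite fin_adj_sym.
by move: uv1; rewrite -(other _ u2 (introN eqP ud)) -(other _ v2 (introN eqP vd)) eqxx.
Qed.

End LargePrime.

Lemma famAge_minimal_prime F : prime3 F ->
  all (essential F) (iota 2 (size (consts F))) -> minimal_prime (famAge F).
Proof.
move=> p3 ess; apply: minimal_primeI; first exact: famAge_hereditary.
  exact: famAge_unbounded.
move=> H /(famAge_transfer p3)[n nP].
(* Then one of the two proper columns has at least [n.*2.+3] vertices: enough for [n] blocks of two,
   and at least the three that [const_present] asks for. *)
exists (n.*2.+3 + n.*2.+3 + size (consts F)) => G [h [hI hV hA]] pG large.
have lt2 : 2 < #|fin_vertex G| by apply: leq_trans large; rewrite !addSn.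
have card := leq_trans large (card_columns hI hV).
have [d d2 nd] : exists2 d, d < 2 & n.*2.+2 < size (column_rows h d).
  case: (ltnP n.*2.+2 (size (column_rows h 0))) => lt0; first by exists 0.
  by exists 1 => //; move: card; rewrite leq_add2r; lia.
by have [f fP] := large_template pG hI hV hA d2 ess lt2 nd; apply: nP fP.
Qed.

(** * Ages of words *)

(* The vertex i of the graph of a word is numbered i + 1 here. *)
Definition wadj (mu : nat -> bool) (i j : nat) : bool :=
  if i < j then mu j.-1 == (j == i.+1)
  else if j < i then mu i.-1 == (i == j.+1) else false.

Lemma wadjC mu i j : wadj mu i j = wadj mu j i.
Proof. by rewrite /wadj; case: ltngtP. Qed.

Lemma wadj_lt mu i j : i < j -> wadj mu i j = (mu j.-1 == (j == i.+1)).
Proof. by rewrite /wadj => ->. Qed.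

Definition wordAge (mu : word) : graph_class := fun H =>
  exists h : fin_vertex H -> nat,
    injective h /\ forall x y, fin_adj x y = wadj mu (h x) (h y).

Lemma adj_word mu i j :
  @adj (G_word mu) i j = wadj mu (word_succ i) (word_succ j).
Proof.
rewrite /adj /= /sym_adj /wadj.
case: i j => [i|] [j|] //=; rewrite ?ltnS ?orbF ?eqSS.
- case: ltngtP => // ij; rewrite ?orbF /=;
  by case: (mu _); case: eqP.
- by case: (mu i); case: eqP.
- by case: (mu j); case: eqP.
Qed.

Lemma Age_word mu : class_eq (Age (G_word mu)) (wordAge mu).
Proof.
move=> H; split=> [/embedsP[f [fI fA]]|[h [hI hA]]].
  exists (fun x => word_succ (f x)); split=> [x y E|x y].
    by apply: fI; move: E; case: (f x) (f y) => [i|] [j|] //= [->].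
  by rewrite -adj_word fA.
apply/embedsP; exists (fun x : H => if h x is n.+1 then Some n else None : G_word mu).
split=> [x y E|x y]; first by apply: hI; move: E; case: (h x) (h y) => [|i] [|j] //= [->].
by rewrite adj_word [RHS]hA; congr wadj; case: (h _).
Qed.

Definition has_word (C : graph_class) (w : seq bool) : Prop :=
  exists G (p : nat -> fin_vertex G), [/\ C G,
    forall i j, i <= size w -> j <= size w -> p i = p j -> i = j &
    forall i j, i < j <= size w -> fin_adj (p i) (p j) = wadj (nth false w) i j].

Lemma has_word_infix C u w : has_word C w -> infix u w -> has_word C u.
Proof.
move=> [G [p [CG pI pA]]] /infixP[s [t E]].
have sw : size w = size s + (size u + size t) by rewrite E !size_cat.
exists G, (fun i => p (size s + i)); split=> // [i j iu ju /pI E'|i j /andP[ij ju]].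
  have le k : k <= size u -> size s + k <= size w.
    by move=> ku; rewrite sw leq_add2l (leq_trans ku) ?leq_addr.
  exact: addnI (E' (le i iu) (le j ju)).
case: j ij ju => // j ij ju.
have ltw : size s + i < size s + j.+1 <= size w.
  by rewrite ltn_add2l ij sw leq_add2l (leq_trans ju) ?leq_addr.
rewrite pA // !wadj_lt ?ltn_add2l // !addnS !eqSS eqn_add2l E /=.
by rewrite nth_cat ltnNge leq_addr /= addKn nth_cat ju.
Qed.

Lemma chain_has_word C (G : fin_graph) (p : nat -> fin_vertex G) m :
  C G -> chain p m -> exists2 w, size w = m & has_word C w.
Proof.
move=> CG [pI pA]; exists (mkseq (fun i => fin_adj (p i.+1) (p i)) m).
  exact: size_mkseq.
exists G, p; split; rewrite ?size_mkseq // => i j /andP[ij jm].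
rewrite wadj_lt // nth_mkseq; last by case: j ij jm.
have -> : j.-1.+1 = j by case: j ij {jm}.
rewrite fin_adj_sym; case: (ltngtP j i.+1) => [||->]; first lia.
  by move=> lt; rewrite pA ?lt //; case: fin_adj.
by case: fin_adj.
Qed.

Lemma wordAge_sub C mu : hereditary C ->
  (forall n, has_word C (factor mu 0 n)) -> subclass (wordAge mu) C.
Proof.
move=> hC fac H [h [hI hA]].
pose n := \max_x h x.
have hn x : h x <= n by apply: leq_bigmax.
have [G [p [CG pI pA]]] := fac n; rewrite size_mkseq in pI pA.
apply: (hC _ G) => //; apply/embedsP; exists (fun x => p (h x)).
split=> [x y /pI E|x y]; first by apply: hI; apply: E.
rewrite [RHS]hA.
have pA' i j : i < j <= n -> fin_adj (p i) (p j) = wadj mu i j.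
  move=> ijn; rewrite pA //; move: ijn => /andP[ij jn].
  by rewrite !wadj_lt // nth_mkseq //; case: j ij jn.
case: (ltngtP (h x) (h y)) => [lt|gt|->]; first by apply: pA'; rewrite lt hn.
  by rewrite wadjC -pA' ?gt ?hn //; apply: fin_adj_sym.
by rewrite /wadj ltnn; apply: fin_adj_irrefl.
Qed.

Definition unbounded (L : seq bool -> Prop) : Prop :=
  forall n, exists2 w, L w & n <= size w.

(** * A recurrent word from a minimal unbounded factorial language *)

Section MinimalLanguage.

Variable L : seq bool -> Prop.
Hypothesis L_infix : forall u w, L w -> infix u w -> L u.
Hypothesis L_unbounded : unbounded L.

(* Run through all the words, discarding each one whose removal, with that of
   all the words containing it, leaves an unbounded language. *)
Fixpoint thinned (k : nat) : seq bool -> Prop :=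
  if k is k'.+1 then fun w => thinned k' w /\
    (let u := odflt [::] (unpickle k') in
     unbounded (fun v => thinned k' v /\ ~~ infix u v) -> ~~ infix u w)
  else L.

Lemma thinned_infix k u w : thinned k w -> infix u w -> thinned k u.
Proof.
elim: k => [|k IH] /=; first exact: L_infix.
move=> [kw av] uw; split; first exact: IH uw.
by move=> /av; apply: contra => /infix_trans; apply.
Qed.

Lemma thinned_unbounded k : unbounded (thinned k).
Proof.
elim: k => [|k IH] // n; pose u : seq bool := odflt [::] (unpickle k).
case: (classic (unbounded (fun v => thinned k v /\ ~~ infix u v))) => [unb|bnd].
  by have [v [kv uv] vn] := unb n; exists v.
by have [w kw wn] := IH n; exists w.
Qed.

Lemma thinned_mono k l w : k <= l -> thinned l w -> thinned k w.
Proof.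
elim: l => [|l IH]; first by rewrite leqn0 => /eqP->.
by rewrite leq_eqVlt => /predU1P[->//|/IH kl] /= [] /kl.
Qed.

Definition minimal_language (w : seq bool) : Prop := forall k, thinned k w.

Lemma minimal_language_infix u w :
  minimal_language w -> infix u w -> minimal_language u.
Proof. by move=> Mw uw k; apply: thinned_infix uw. Qed.

(** Compactness: if each of the finitely many words of length [n] were discarded at some stage, a
    later stage would contain no word of length [n], hence no longer one. *)
Lemma minimal_language_size n : exists2 w, minimal_language w & size w = n.
Proof.
apply: NNPP => none.
have /fin_all_exists[K KP] : forall w : n.-tuple bool, exists k, ~ thinned k w.
  move=> w; apply: NNPP => all; apply: none; exists w; last exact: size_tuple.
  by move=> k; apply: NNPP => nk; apply: all; exists k.
have [w kw wn] := thinned_unbounded (\max_w K w) n.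
have tn : size (take n w) == n by rewrite size_takel.
apply: (KP (Tuple tn)); apply: (@thinned_mono _ (\max_w K w)).
  exact: leq_bigmax.
exact: thinned_infix kw (infix_take _ _).
Qed.

(** The word [u] was examined at stage [pickle u] and kept, so the words of that stage that avoid it
    are bounded in length. *)
Lemma minimal_language_recurs u : minimal_language u ->
  exists n, forall w, minimal_language w -> n <= size w -> infix u w.
Proof.
move=> Mu; have [_] := Mu (pickle u).+1; rewrite pickleK [odflt _ _]/= => av.
apply: NNPP => none; have : ~~ infix u u.
  apply: av => n; apply: NNPP => all; apply: none; exists n => w Mw wn.
  apply/negPn/negP => nuw; apply: all; exists w => //; split=> //; exact: Mw.
by rewrite infix_refl.
Qed.

(** As in König's lemma: an extendable word has an extendable successor, and [minimal_word] follows
    such successors. *)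
Definition extendable (u : seq bool) : Prop :=
  unbounded (fun v => minimal_language (u ++ v)).

Lemma extendable_rcons u :
  extendable u -> ~ extendable (rcons u true) -> extendable (rcons u false).
Proof.
move=> ext /not_all_ex_not[m nm] n.
have [[|b v] Muv le] := ext (maxn m n).+1; first by [].
exists v; last by move: le => /=; lia.
case: b Muv le => Muv le; last by rewrite cat_rcons.
case: nm; exists v; first by rewrite cat_rcons.
by move: le => /=; lia.
Qed.

Fixpoint prefix_word (n : nat) : seq bool :=
  if n is n'.+1 then
    let u := prefix_word n' in
    rcons u (if excluded_middle_informative (extendable (rcons u true))
             then true else false)
  else [::].

Definition minimal_word : word := fun n => last false (prefix_word n.+1).

Lemma prefix_wordE n : prefix_word n = factor minimal_word 0 n.
Proof.
elim: n => [|n IH] //; rewrite /factor mkseqS -/(factor minimal_word 0 n) -IH.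
by rewrite /minimal_word /= last_rcons.
Qed.

Lemma extendable_prefix n : extendable (prefix_word n).
Proof.
elim: n => [|n IH] /=.
  by move=> m; have [w Mw wm] := minimal_language_size m; exists w; rewrite ?wm.
case: (excluded_middle_informative _) => // ne; exact: extendable_rcons ne.
Qed.

Lemma factor_minimal p n : minimal_language (factor minimal_word p n).
Proof.
have [v Mv _] := extendable_prefix (p + n) 0.
have Mp : minimal_language (prefix_word (p + n)).
  exact: minimal_language_infix Mv (prefix_infix _ _).
apply: (minimal_language_infix Mp); rewrite prefix_wordE.
rewrite /factor /mkseq iotaD map_cat.
have -> : iota (0 + p) n = [seq p + k | k <- iota 0 n] by rewrite -iotaDl addn0.
by rewrite -map_comp; apply: suffix_infix.
Qed.

Lemma minimal_word_recurrent : uniformly_recurrent minimal_word.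
Proof.
move=> n.
have /fin_all_exists[K KP] : forall u : n.-tuple bool, exists k,
    minimal_language u -> forall w, minimal_language w -> k <= size w -> infix u w.
  move=> u; case: (classic (minimal_language u)) => [Mu|nMu]; last by exists 0.
  by have [k kP] := minimal_language_recurs Mu; exists k.
exists (\max_u K u) => p q.
have fn : size (factor minimal_word p n) == n by rewrite size_mkseq.
apply: (KP (Tuple fn)); [exact: factor_minimal|exact: factor_minimal|].
by rewrite size_mkseq; apply: leq_bigmax.
Qed.

End MinimalLanguage.

Lemma unbounded_words C : hereditary C -> unbounded (has_word C) ->
  exists2 mu, uniformly_recurrent mu & subclass (wordAge mu) C.
Proof.
move=> hC unb; exists (minimal_word (has_word C)).
  by apply: minimal_word_recurrent => // u w; apply: has_word_infix.
apply: wordAge_sub => // n.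
by apply: (@factor_minimal _ (@has_word_infix C) unb 0 n 0).
Qed.

Lemma recurrent_occurrence mu n : uniformly_recurrent mu ->
  exists m, forall p, exists r,
    [/\ p <= r, r + n <= p + m & forall k, k < n -> mu (r + k) = mu k].
Proof.
move=> /(_ n)[m mP]; exists m => p.
have /infixP[s [t E]] := mP 0 p; have sz := congr1 size E.
rewrite !size_cat !size_mkseq in sz.
exists (p + size s); split=> [||k kn]; [by rewrite leq_addr| |].
  by rewrite sz -addnA leq_add2l leq_add2l leq_addr.
have := congr1 (fun l => nth false l (size s + k)) E.
rewrite nth_cat ltnNge leq_addr /= addKn nth_cat size_mkseq kn !nth_mkseq //.
  by rewrite addnA.
by rewrite sz ltn_add2l ltn_addr.
Qed.

Lemma wadj_next (mu : word) k : wadj mu k k.+1 = mu k.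
Proof. by rewrite wadj_lt // eqxx; case: (mu _). Qed.

Lemma wadj_far (mu : word) k l : k.+1 < l -> wadj mu k l = ~~ mu l.-1.
Proof.
by move=> kl; rewrite wadj_lt ?(ltnW kl) // gtn_eqF //; case: (mu _).
Qed.

Lemma wadj_twice (mu : word) b i : wadj mu i.+1 i.+2 = b -> wadj mu i i.+2 = b -> False.
Proof. by rewrite wadj_next wadj_far //= => <-; case: (mu _). Qed.

(** * Primality of word graphs *)

Section WordModule.

Variables (mu : word) (n : nat) (A : pred nat) (i j k : nat).
Hypothesis n3 : 3 < n.
(** Exceptional letters near the ends can destroy primality: if exactly the first two letters differ
    from all the others, then all vertices but 1 form a module. The margins exclude such cases. *)
Hypothesis nice : (forall a b, a < n -> b < n -> mu a = mu b) \/
  (exists a b, [/\ 1 < a, a.+2 < n, 1 < b, b.+2 < n & mu a != mu b]).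
Hypothesis mod : forall k a b, k <= n -> a <= n -> b <= n ->
  ~~ A k -> A a -> A b -> wadj mu k a = wadj mu k b.
Hypotheses (ij : i < j) (jn : j <= n) (Ai : A i) (Aj : A j).
Hypothesis min : forall l, l < j -> l != i -> ~~ A l.

(** Vertex [l.+1] sees its immediate predecessor [l] and the earlier vertex [i] differently, so it
    cannot stay outside the module. *)
Lemma word_module_up l : j <= l <= n -> A l.
Proof.
move=> /andP[jl ln]; elim: l jl ln => [|l IH]; first by rewrite leqn0 => /eqP <-.
rewrite leq_eqVlt ltnS => /predU1P[<- //|jl ln]; have Al := IH jl (ltnW ln).
apply/negPn/negP => nA; have il : i < l by apply: leq_trans jl.
have le : i <= n by rewrite (leq_trans (ltnW il)) // ltnW.
have := mod ln (ltnW ln) le nA Al Ai.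
by rewrite ![wadj mu l.+1 _]wadjC wadj_next wadj_far //=; case: (mu l).
Qed.

Hypotheses (kn : k <= n) (nAk : ~~ A k).

Lemma word_module_eq l a : l < j -> l != i -> A a -> a <= n ->
  wadj mu l a = wadj mu l n.
Proof.
move=> lj li Aa an; apply: mod => //; last by apply: word_module_up; rewrite jn leqnn.
  by rewrite (leq_trans (ltnW lj)).
exact: min.
Qed.

(** Here the module is the pair of [i] and [n]. If [i] is at least 2, its two predecessors both see
    [i] as they see [n], against [wadj_twice]; so [i] is at most 1, and the later vertices force all
    the letters within the margins of [nice] to equal the last one. *)
Lemma word_module_last : j = n -> False.
Proof.
move=> jE; have nE : n = n.-1.+1 by case: n n3.
have eqi l : l.+1 < n -> l != i -> wadj mu l i = ~~ mu n.-1.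
  move=> ln li; have lj : l < j by rewrite jE ltnW.
  by rewrite word_module_eq ?wadj_far // (leq_trans (ltnW ij)).
have [i1|i2] := leqP i 1; last first.
  have iE : i = i.-2.+2 by case: i i2 => [|[]].
  apply: (@wadj_twice mu (~~ mu n.-1) i.-2); rewrite -iE; apply: eqi; lia.
have eqn1 : wadj mu n.-1 i = mu n.-1.
  rewrite word_module_eq //; [by rewrite {2}nE wadj_next|lia|lia|lia].
have far a : 1 < a -> a.+2 < n -> mu a = mu n.-1.
  move=> a1 an; have := eqi a.+1 an _; rewrite wadjC wadj_far /=; last lia.
  by move=> E; apply/negb_inj/E; lia.
case: nice => [const|[a [b [a1 an b1 bn]]]]; last by rewrite !far ?eqxx.
move: eqn1; rewrite wadjC wadj_far; last lia.
by rewrite (const _ n.-1); [case: (mu _)|lia|lia].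
Qed.

(** The outside vertex [k] sees the tail from [j] on alike, which makes the letters from [j] on
    equal to [c]. The other vertices below [j] then force [j = 2] and a letter [~~ c] among the
    first two, which both cases of [nice] forbid. *)
Lemma word_module_inner : j < n -> False.
Proof.
move=> jn'; have kj : k < j.
  by rewrite ltnNge; apply: contra nAk => jk; apply: word_module_up; rewrite jk.
have ki : k != i by apply: contraNneq nAk => ->.
set c := mu n.-1.
have eqc l a : l < j -> l != i -> A a -> a <= n -> wadj mu l a = ~~ c.
  by move=> lj li Aa an; rewrite word_module_eq // wadj_far // (leq_ltn_trans lj).
have tail a : j <= a < n -> mu a = c.
  move=> /andP[ja an]; apply: negb_inj; rewrite -(eqc k a.+1) //.
    by rewrite wadj_far //= ltnS (leq_trans kj).
  by apply: word_module_up; rewrite an leqW.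
have [j2 [e e2 eE]] : j = 2 /\ exists2 e, e < 2 & mu e = ~~ c.
  have iE : i <= n by rewrite (leq_trans (ltnW ij)).
  have [jE|jE] := eqVneq j i.+1.
    have i0 : 0 < i by move: kj ki jE; lia.
    have [i1|i2] := leqP i 1.
      have iE1 : i = 1 by apply/eqP; rewrite eqn_leq i1.
      split; first by rewrite jE iE1.
      exists 0 => //; rewrite -wadj_next -iE1; apply: eqc => //.
        exact: leq_trans ij.
      by rewrite iE1.
    have i2E : i = i.-2.+2 by lia.
    by case: (@wadj_twice mu (~~ c) i.-2); rewrite -i2E; apply: eqc => //; lia.
  have jE' : j = j.-1.+1 by lia.
  have mj : mu j.-1 = ~~ c.
    rewrite -wadj_next -jE'; apply: eqc => //; lia.
  have none l : l.+1 < j -> l != i -> False.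
    move=> lj li; have := eqc l j (ltnW lj) li Aj jn.
    by rewrite wadj_far // mj; case: (c).
  have jj : j = 2.
    have [j3|j3] := leqP j 2; first by lia.
    by case: (eqVneq i 0) => i0; [case: (none 1); lia|case: (none 0); lia].
  by split=> //; exists 1 => //; rewrite -mj jj.
case: nice => [const|[a [b [a1 an b1 bn]]]].
  have en : e < n by rewrite (ltn_trans e2) // -j2.
  have n1 : n.-1 < n by lia.
  by have := const e n.-1 en n1; rewrite eE /c; case: (mu _).
rewrite (tail a) ?(tail b) ?eqxx //; rewrite j2 ?a1 ?b1 /=; lia.
Qed.

End WordModule.

Definition word_graph (mu : word) (n : nat) : fin_graph.
Proof.
apply: (@FinGraph 'I_n.+1 (fun x y => wadj mu x y)) => [x y|x].
  exact: wadjC.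
by rewrite /wadj ltnn.
Defined.

Lemma word_graph_prime (mu : word) n : 3 < n ->
  (forall a b, a < n -> b < n -> mu a = mu b) \/
  (exists a b, [/\ 1 < a, a.+2 < n, 1 < b, b.+2 < n & mu a != mu b]) ->
  prime_graph (word_graph mu n).
Proof.
move=> n3 nice A mod.
pose B : pred nat := fun k => [exists x in A, nat_of_ord x == k].
have BE (x : 'I_n.+1) : B x = (x \in A).
  apply/exists_inP/idP => [[y yA /eqP /val_inj <-] //|xA]; by exists x.
have Bmod k a b : k <= n -> a <= n -> b <= n -> ~~ B k -> B a -> B b ->
    wadj mu k a = wadj mu k b.
  rewrite -[k <= n]ltnS -[a <= n]ltnS -[b <= n]ltnS => kn an bn.
  rewrite (BE (Ordinal kn)) (BE (Ordinal an)) (BE (Ordinal bn)) => /mod mk aA bA.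
  case: mk => mk; first by rewrite [LHS](mk _ aA) [RHS](mk _ bA).
  by rewrite [LHS](negbTE (mk _ aA)) [RHS](negbTE (mk _ bA)).
have [->|/set0Pn[x0 x0A]] := eqVneq A set0; first by constructor 1.
have exB : exists i, B i by exists x0; rewrite BE.
case: (ex_minnP exB) => i Bi imin.
case: (classic (exists j, B j && (j != i))) => [exj|none]; last first.
  constructor 2; exists x0; apply/setP => x; rewrite inE.
  have eqi (y : 'I_n.+1) : y \in A -> nat_of_ord y = i.
    move=> yA; apply/eqP/negPn/negP => yi; apply: none; exists y; by rewrite BE yA.
  apply/idP/eqP => [xA|-> //]; apply: val_inj; by rewrite /= !eqi.
case: (ex_minnP exj) => j /andP[Bj ji] jmin; constructor 3.
apply/setP => x; rewrite [RHS]inE; apply/negPn/negP; rewrite -BE => nBx.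
have Bn l : B l -> l <= n by case/exists_inP => y _ /eqP <-; rewrite -ltnS.
have ij : i < j by rewrite ltn_neqAle eq_sym ji imin.
have min l : l < j -> l != i -> ~~ B l.
  by move=> lj li; apply/negP => Bl; have := jmin l; rewrite Bl li leqNgt lj => /(_ isT).
have jn := Bn _ Bj; have xn : x <= n by rewrite -ltnS.
have := jn; rewrite leq_eqVlt => /predU1P[jE|jn'].
  exact: (word_module_last n3 nice Bmod ij jn Bi Bj min xn nBx jE).
exact: (word_module_inner n3 nice Bmod ij jn Bi Bj min xn nBx jn').
Qed.

Lemma recurrent_prime mu : uniformly_recurrent mu ->
  forall N, exists G, [/\ wordAge mu G, prime_graph G & N <= #|fin_vertex G|].
Proof.
move=> rec N.
have [n [Nn n3 nice]] : exists n, [/\ N <= n, 3 < n &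
  (forall a b, a < n -> b < n -> mu a = mu b) \/
  (exists a b, [/\ 1 < a, a.+2 < n, 1 < b, b.+2 < n & mu a != mu b])].
  case: (classic (forall a b, mu a = mu b)) => [const|].
    exists (maxn N 4); split; [exact: leq_maxl|exact: leq_maxr|].
    by left=> a b _ _; apply: const.
  move=> /not_all_ex_not[a /not_all_ex_not[b ab]].
  (* Recurrence moves the two distinct letters to positions from 2 on; [n] is then taken large
     enough to leave the margin at the other end. *)
  have [m /(_ 2)[r [r2 _ rE]]] := recurrent_occurrence (maxn a b).+1 rec.
  exists (maxn N (r + (maxn a b).+4)); split; first exact: leq_maxl.
    by rewrite leq_max !addnS orbT.
  have lt c : c <= maxn a b -> (r + c).+2 < maxn N (r + (maxn a b).+4).
    move=> le; apply: leq_trans (leq_maxr _ _).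
    by rewrite -!addnS leq_add2l !ltnS leqW.
  right; exists (r + a), (r + b); rewrite !lt ?leq_maxl ?leq_maxr //.
  rewrite !(leq_trans r2) ?leq_addr // !rE ?ltnS ?leq_maxl ?leq_maxr //.
  by split=> //; apply/eqP.
exists (word_graph mu n); split; last by rewrite card_ord (leq_trans Nn).
  by exists (fun x => nat_of_ord x); split=> //; apply: val_inj.
exact: word_graph_prime.
Qed.

(** * Large prime graphs in the age of a word *)

Section LargeWord.

Variables (mu : word) (G : fin_graph).
Notation V := (fin_vertex G).
Variable h : V -> nat.
Hypotheses (pG : prime_graph G) (hI : injective h).
Hypothesis hA : forall x y, fin_adj x y = wadj mu (h x) (h y).

Definition positions : seq nat := sort leq [seq h x | x <- enum V].

Lemma positionsP k : reflect (exists x, h x = k) (k \in positions).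
Proof.
rewrite mem_sort; apply: (iffP mapP) => [[x _ ->]|[x <-]]; first by exists x.
by exists x; rewrite ?mem_enum.
Qed.

Lemma size_positions : size positions = #|V|.
Proof. by rewrite size_sort size_map -cardE. Qed.

Lemma positions_lt i j : i < j < size positions -> nth 0 positions i < nth 0 positions j.
Proof.
case/andP=> ij jd; apply: (sorted_ltn_nth ltn_trans 0) => //; last exact: ltn_trans jd.
rewrite ltn_sorted_uniq_leq sort_sorted ?andbT ?sort_uniq; last exact: leq_total.
by rewrite map_inj_uniq ?enum_uniq.
Qed.

(* If some position is skipped after the second one, the vertices before the
   gap form a module. *)
Lemma positions_consecutive i : 0 < i -> i.+1 < size positions ->
  nth 0 positions i.+1 = (nth 0 positions i).+1.
Proof.
move=> i0 il; apply/eqP; rewrite eqn_leq positions_lt ?ltnSn // andbT leqNgt.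
apply/negP => gap.
have ex k : k < size positions -> exists x, h x = nth 0 positions k.
  by move=> kl; apply/positionsP/mem_nth.
have [x hx] := ex 0 (ltn_trans (ltn0Sn _) il).
have [y hy] := ex i (ltnW il).
have [z hz] := ex i.+1 il.
pose A := [set x | h x <= nth 0 positions i].
have mod : is_module A.
  move=> u; rewrite inE -ltnNge => ui.
  have far v : v \in A -> fin_adj u v = ~~ mu (h u).-1.
    rewrite inE hA => vi; rewrite wadjC wadj_far //.
    apply: leq_ltn_trans (leq_trans gap _); first by rewrite ltnS.
    have /positionsP : exists w, h w = h u by exists u.
    case/(nthP 0) => k kl ku; rewrite -ku leqNgt; apply/negP => lt.
    have ki : k <= i.
      rewrite leqNgt; apply/negP => ik; have : i.+1 <= k by [].
      rewrite leq_eqVlt => /predU1P[E|ik1]; first by rewrite E ltnn in lt.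
      by have := positions_lt (introT andP (conj ik1 kl)); rewrite ltnNge ltnW.
    move: ui; rewrite -ku ltnNge; move: ki; rewrite leq_eqVlt => /predU1P[->|ki].
      by rewrite leqnn.
    by rewrite ltnW // positions_lt // ki ltnW.
  by case: (mu (h u).-1) far => far; [right|left] => v /far ->.
have xA : x \in A.
  by rewrite inE hx ltnW // positions_lt // i0 ltnW.
have yA : y \in A by rewrite inE hy.
have := prime_module pG mod xA yA; have -> : x != y.
  apply/eqP => E; have := @positions_lt 0 i; rewrite i0 (ltnW il) -hx -hy E ltnn.
  by move=> /(_ isT).
move=> /(_ isT) AT; have : z \in A by rewrite AT inE.
by rewrite inE hz leqNgt positions_lt ?ltnSn.
Qed.

Lemma positions_interval k i : nth 0 positions 1 <= k -> k <= nth 0 positions 1 + i ->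
  i.+1 < size positions -> exists x, h x = k.
Proof.
move=> k1 ki il; pose l := k - nth 0 positions 1.
have E m : m.+1 < size positions -> nth 0 positions m.+1 = nth 0 positions 1 + m.
  elim: m => [|m IH] ml; first by rewrite addn0.
  by rewrite positions_consecutive // IH ?addnS // ltnW.
apply/positionsP; have lk : nth 0 positions 1 + l = k by rewrite subnKC.
have lsz : l.+1 < size positions by apply: leq_ltn_trans il; rewrite ltnS leq_subLR.
by rewrite -lk -E // mem_nth.
Qed.

End LargeWord.

Lemma wordAge_minimal_prime mu : uniformly_recurrent mu -> minimal_prime (wordAge mu).
Proof.
move=> rec; apply: minimal_primeI; last 1 first.
- move=> H [h [hI hA]].
  pose n := \max_x h x.
  have hn x : h x <= n by apply: leq_bigmax.
  have [m mP] := recurrent_occurrence n rec.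
  (* A window of [m] letters needs [m.+1] consecutive positions, and the first position may lie
     apart from the others. *)
  exists m.+2 => G [g [gI gA]] pG large.
  have [r [pr rm rE]] := mP (nth 0 (positions g) 1).
  have sz : m.+1 < size (positions g) by rewrite size_positions.
  have pick x : exists y, g y == r + h x.
    have [||y <-] := @positions_interval mu G g pG gI gA (r + h x) m _ _ sz.
    - exact: leq_trans pr (leq_addr _ _).
    - by apply: leq_trans rm; rewrite leq_add2l.
    - by exists y.
  have pickE x := eqP (xchooseP (pick x)).
  exists (fun x => xchoose (pick x)); split=> [x y E|x y].
    by apply/hI/(@addnI r); rewrite -!pickE E.
  have shift i j : i < j <= n -> wadj mu (r + i) (r + j) = wadj mu i j.
    case: j => // j /andP[ij jn].
    by rewrite !wadj_lt ?ltn_add2l // addnS /= rE // !eqSS eqn_add2l.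
  rewrite [LHS]gA [RHS]hA !pickE.
  case: (ltngtP (h x) (h y)) => [lt|gt|->]; first by rewrite shift ?lt ?hn.
    by rewrite wadjC shift ?gt ?hn // wadjC.
  by rewrite /wadj !ltnn.
- move=> H K /embedsP[f [fI fA]] [h [hI hA]]; exists (fun x => h (f x)).
  by split=> [x y /hI/fI //|x y]; rewrite -hA -[LHS]fA.
- exact: recurrent_prime.
Qed.

(** * Finding a listed graph in a pattern *)

Definition in_columns (c : nat) (p : placement) (F : template) : bool :=
  [&& col p 0 < c, col p 1 < c &
      all (fun k => (spot p k).1 < c) (iota 2 (size (consts F)))].

Lemma realized_place C c P p (F : template) :
  realized C c P -> in_columns c p F -> fits p F P ->
  forall n, exists G (f : nat * nat -> fin_vertex G),
    [/\ C G, prime_graph G & forall u v, valid F u -> valid F v ->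
       u.2 < n -> v.2 < n -> fin_adj (f u) (f v) = padj F u v].
Proof.
move=> real /and3P[c0 c1 /allP cs] fit n.
have [G [f [CG pG fA]]] := real n.*2.+2.
exists G, (fun u => f (place p n u)); split=> // u v vu vv un vn.
have inside w : valid F w -> w.2 < n ->
    ((place p n w).1 < c) && ((place p n w).2 < n.*2.+2).
  move=> vw wn; rewrite /place; case: (ltnP w.1 2) => w2 /=.
    case/and5P: fit => o0 o1 _ _ _.
    have ow : off p w.1 <= 1 by case: (w.1) w2 => [|[|]].
    apply/andP; split; first by case: (w.1) w2 => [|[|]].
    move: ow wn; clear; lia.
  have wk := valid_const vw w2; case/and5P: fit => _ _ /allP/(_ _ wk) sw _ _.
  rewrite cs //=; case: ((spot p w.1).2) sw => [|[|]] // _.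
  by rewrite mul1n.
case/andP: (inside u vu un) => ? ?; case/andP: (inside v vv vn) => ? ?.
by rewrite fA // (fits_padj fit).
Qed.

Lemma realized_famAge C c P p (F : template) : hereditary C -> prime3 F ->
  realized C c P -> in_columns c p F -> fits p F P -> subclass (famAge F) C.
Proof.
move=> hC p3 real inc fit H /(famAge_transfer p3)[n nP].
have [G [f [CG _ fA]]] := realized_place real inc fit n.
by apply: (hC _ G) => //; apply/embedsP/(nP G f).
Qed.

Lemma realized_template C c P p (F : template) : consts F = [::] ->
  realized C c P -> in_columns c p F -> fits p F P -> realized C 2 F.
Proof.
move=> F0 real inc fit N.
have [G [f [CG pG fA]]] := realized_place real inc fit N.
exists G, f; split=> // u v u2 v2 uN vN.
by apply: fA => //; rewrite /valid ?u2 ?v2.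
Qed.

Definition rev_pattern (P : pattern) : pattern :=
  Pattern (fun i j => later P j i) (same P).

Lemma realized_rev C c P : realized C c P -> realized C c (rev_pattern P).
Proof.
move=> real N; have [G [f [CG pG fA]]] := real N.
exists G, (fun u => f (u.1, N - u.2.+1)); split=> // [[i k] [j l]] /= ic jc kN lN.
rewrite fA //=; [|lia|lia]; rewrite /padj /=.
have -> : (N - k.+1 < N - l.+1) = (l < k) by lia.
have -> : (N - l.+1 < N - k.+1) = (k < l) by lia.
by case: ltngtP.
Qed.

Definition table (l q : seq (seq bool)) : pattern :=
  Pattern (fun i j => nth false (nth [::] l i) j)
          (fun i j => nth false (nth [::] q i) j).

(** Tabulated, so that a pattern on few columns is given by finitely many bits, which [all_bits]
    runs through. *)
Definition restrict (P : pattern) (cs : seq nat) : pattern :=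
  table [seq [seq later P i j | j <- cs] | i <- cs]
        [seq [seq same_row P i j | j <- cs] | i <- cs].

Lemma same_row_restrict P cs i j : i < size cs -> j < size cs ->
  same_row (restrict P cs) i j = same_row P (nth 0 cs i) (nth 0 cs j).
Proof.
move=> ic jc; rewrite {1}/same_row /=.
case: (ltngtP i j) => [_|_|->]; last by rewrite same_rowxx.
  by rewrite (nth_map 0) // (nth_map 0).
by rewrite (nth_map 0) // (nth_map 0) // same_rowC.
Qed.

Lemma realized_restrict C c P cs : all (fun i => i < c) cs ->
  realized C c P -> realized C (size cs) (restrict P cs).
Proof.
move=> /allP csc real N; have [G [f [CG pG fA]]] := real N.
have csn i : i < size cs -> nth 0 cs i < c by move=> ic; apply/csc/mem_nth.
exists G, (fun u => f (nth 0 cs u.1, u.2)); split=> // [[i k] [j l]] /= ic jc kN lN.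
rewrite fA ?csn // /padj same_row_restrict //.
have lE a b : a < size cs -> b < size cs ->
    later (restrict P cs) a b = later P (nth 0 cs a) (nth 0 cs b).
  by move=> ac bc; rewrite /= (nth_map 0) // (nth_map 0).
by rewrite !lE.
Qed.

Fixpoint all_bits (n : nat) (f : seq bool -> bool) : bool :=
  if n is n'.+1 then
    all_bits n' (fun s => f (true :: s)) && all_bits n' (fun s => f (false :: s))
  else f [::].

Lemma all_bitsP n f s : all_bits n f -> size s = n -> f s.
Proof.
elim: n f s => [|n IH] f [|b s] //= /andP[t u] [sn].
by case: b; [apply: (IH (fun s => f (true :: s)))|apply: (IH (fun s => f (false :: s)))].
Qed.

Definition neg_template (F : template) : template :=
  Template (~~ l00 F) (~~ l01 F) (~~ l10 F) (~~ l11 F) (~~ q01 F)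
    [seq (~~ k.1, ~~ k.2) | k <- consts F] (~~ cc F).

(* Columns 0 and 1 are those of u and v in S and of a and b elsewhere; the
   constants are c in S, x in D, and a_oo, x in F. *)
Definition template_S := Template false false false false true [:: (true, false)] false.
Definition template_B := Template false true false false true [::] false.
Definition template_M := Template false true true false false [::] false.
Definition template_T := Template true false false false true [::] false.
Definition template_D := Template false false true true true [:: (true, false)] false.
Definition template_F :=
  Template false false true true true [:: (false, true); (false, false)] true.

(** The order is that of [list_L]. The complement of D is absent because it has the same age:
    exchanging the a's and the b's turns it into D with i > j in place of i >= j, and a shift of
    indices embeds each of the two in the other. *)
Definition templates : seq template :=
  [:: template_S; neg_template template_S; template_B; neg_template template_B;
      template_M; neg_template template_M; template_T; neg_template template_T;
      template_D; template_F; neg_template template_F].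

(* Every tail of rows of this template is a module. *)
Definition half_split := Template false false true true true [::] false.

Notation template_at := (nth template_S templates).

Definition contains_listed (C : graph_class) : Prop :=
  exists2 i, i < size templates & subclass (famAge (template_at i)) C.

Lemma templates_ok i : i < size templates ->
  prime3 (template_at i) /\
  all (essential (template_at i)) (iota 2 (size (consts (template_at i)))).
Proof.
have ok : all (fun i => prime3 (template_at i) &&
  all (essential (template_at i)) (iota 2 (size (consts (template_at i)))))
  (iota 0 (size templates)) by vm_compute.
move=> it; have /(allP ok)/andP[] : i \in iota 0 (size templates) by rewrite mem_iota.
exact: conj.
Qed.

Definition mk_placement (c0 c1 o0 o1 : nat) (s2 s3 : nat * nat) : placement :=
  Placement (fun i => if i == 0 then c0 else c1)
    (fun i => if i == 0 then o0 else o1) (fun k => if k == 2 then s2 else s3).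

Definition placed (n : nat) (P : pattern) (F : template) (p : placement) : bool :=
  in_columns n p F && fits p F P.

Definition found (n : nat) (P : pattern) (cs : seq (nat * placement)) : bool :=
  has (fun c => (c.1 < size templates) && placed n P (template_at c.1) c.2) cs.

Definition split_found (n : nat) (P : pattern) (cs : seq (nat * nat)) : bool :=
  has (fun c => placed n P half_split (mk_placement c.1 c.2 1 0 (0, 0) (0, 0)) ||
    placed n (rev_pattern P) half_split (mk_placement c.1 c.2 1 0 (0, 0) (0, 0))) cs.

(** For [c] false the two columns induce a perfect matching, for [c] true its complement. *)
Definition matched (P : pattern) (c : bool) (i j : nat) : bool :=
  [&& later P i i == c, later P i j == c, later P j i == c, later P j j == c &
      same_row P i j == ~~ c].

(* With columns 0 and 1 as in [half_split], tails of rows remain modules when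
   column i is added. *)
Definition nested (P : pattern) (i : nat) : bool :=
  [&& later P i 0 == later P i 1, later P i 1 == later P i i,
      ~~ later P 0 i & later P 1 i].

(** Each entry is an index in [templates] with a placement to try. Nothing is claimed for these
    lists except what the checks below compute. *)
Definition two_columns_witnesses : seq (nat * placement) :=
  let o := (0, 0) in
  [:: (2, mk_placement 0 1 0 0 o o); (2, mk_placement 1 0 0 1 o o);
    (3, mk_placement 0 1 0 0 o o);
      (3, mk_placement 1 0 0 1 o o); (4, mk_placement 0 1 0 0 o o);
        (5, mk_placement 0 1 0 0 o o);
      (6, mk_placement 0 1 0 0 o o); (6, mk_placement 1 0 0 0 o o);
        (7, mk_placement 0 1 0 0 o o);
      (7, mk_placement 1 0 0 0 o o)].

Definition matching_witnesses : seq (nat * placement) :=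
  let o := (0, 0) in
  [:: (0, mk_placement 0 1 0 0 (2, 0) o); (0, mk_placement 1 0 0 0 (2, 0) o);
      (0, mk_placement 0 1 0 0 (2, 1) o); (0, mk_placement 1 0 0 0 (2, 1) o);
      (1, mk_placement 0 1 0 0 (2, 0) o); (1, mk_placement 1 0 0 0 (2, 0) o);
      (1, mk_placement 0 1 0 0 (2, 1) o); (1, mk_placement 1 0 0 0 (2, 1) o);
      (2, mk_placement 0 2 0 1 o o); (2, mk_placement 2 0 0 1 o o);
      (3, mk_placement 0 2 0 1 o o); (3, mk_placement 2 0 0 1 o o);
      (4, mk_placement 0 2 0 0 o o); (4, mk_placement 1 2 0 0 o o);
      (5, mk_placement 0 2 0 0 o o); (5, mk_placement 1 2 0 0 o o);
      (6, mk_placement 0 2 0 0 o o); (6, mk_placement 1 2 0 0 o o);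
      (6, mk_placement 2 0 0 0 o o); (6, mk_placement 2 1 0 0 o o);
      (7, mk_placement 0 2 0 0 o o); (7, mk_placement 1 2 0 0 o o);
      (7, mk_placement 2 0 0 0 o o); (7, mk_placement 2 1 0 0 o o)].

(** Here [z] is the newest column and [w] a candidate for a_oo. In the last row, columns 0 and 1
    qualify too: their vertices see every earlier b and no earlier a. Hence [w] may be 1. *)
Definition half_split_witnesses (w z : nat) : seq (nat * placement) :=
  let o := (0, 0) in
  [:: (8, mk_placement 0 1 1 0 (z, 0) o); (8, mk_placement 0 1 1 0 (z, 1) o);
      (9, mk_placement 0 1 1 0 (0, 1) (z, 1)); (9, mk_placement 0 1 1 0 (w, 1) (z, 1));
      (10, mk_placement 1 0 1 0 (0, 1) (z, 1)); (10, mk_placement 1 0 1 0 (w, 1) (z, 1));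
      (2, mk_placement z 0 0 1 o o); (6, mk_placement z 0 0 0 o o);
        (10, mk_placement 1 0 1 0 (z, 0) (1, 0));
      (0, mk_placement z 0 0 0 (1, 1) o); (9, mk_placement 0 1 1 0 (w, 0) (z, 0));
      (9, mk_placement 0 1 1 0 (z, 1) (z, 0))].

(** * Exhaustive checks on small patterns *)

Lemma two_columns_check : all_bits 5 (fun s =>
  if s is [:: a; b; c; d; q] then
    let P := table [:: [:: a; b]; [:: c; d]] [:: [:: false; q]; [:: q; false]] in
    [|| q == c, found 2 P two_columns_witnesses, split_found 2 P [:: (0, 1); (1, 0)],
        matched P false 0 1 | matched P true 0 1]
  else true).
Proof. by vm_compute. Qed.

(** Columns 0 and 1 are matched, and column 2 is the next vertex of the chain, which sees exactly
    one of them in its own row. If nothing is found, it is matched with one of the two, and the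
    argument can be repeated. *)
Lemma matching_check : all_bits 7 (fun s =>
  if s is [:: c; px; py; pp; xp; yp; e] then
    let P := table [:: [:: c; c; xp]; [:: c; c; yp]; [:: px; py; pp]]
      [:: [:: false; ~~ c; e]; [:: ~~ c; false; ~~ e]; [:: e; ~~ e; false]] in
    [|| found 3 P matching_witnesses, split_found 3 P [:: (0, 2); (2, 0)],
        matched P c 0 2 | matched P c 1 2]
  else true).
Proof. by vm_compute. Qed.

(** In the last alternative, every vertex of column 2 sees all of column 1 and nothing of column 0,
    as a_oo does in F. *)
Lemma half_split_check : all_bits 6 (fun s =>
  if s is [:: pa; pb; pp; ap; bp; e] then
    let P := table [:: [:: false; false; ap]; [:: true; true; bp]; [:: pa; pb; pp]]
      [:: [:: false; true; e]; [:: true; false; ~~ e]; [:: e; ~~ e; false]] in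
    [|| found 3 P (half_split_witnesses 1 2), nested P 2 |
        [&& ~~ pa, pb, ~~ ap, bp & ~~ e]]
  else true).
Proof. by vm_compute. Qed.

(** Column 2 consists of copies of a_oo. In its own row, column 3 sees columns 0 and 1 alike and
    column 2 differently, as x does in F or its opposite. *)
Lemma apex_check : all_bits 9 (fun s =>
  if s is [:: ww; e; za; zb; zw; zz; az; bz; wz] then
    let P := table
      [:: [:: false; false; false; az]; [:: true; true; true; bz];
          [:: false; true; ww; wz]; [:: za; zb; zw; zz]]
      [:: [:: false; true; false; e]; [:: true; false; true; e];
          [:: false; true; false; ~~ e]; [:: e; e; ~~ e; false]] in
    found 4 P (half_split_witnesses 2 3) || nested P 3
  else true).
Proof. by vm_compute. Qed.

Lemma nested_check : all_bits 11 (fun s =>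
  if s is [:: t; qa; qb; e; za; zb; zw; zz; az; bz; wz] then
    let P := table
      [:: [:: false; false; false; az]; [:: true; true; true; bz];
          [:: t; t; t; wz]; [:: za; zb; zw; zz]]
      [:: [:: false; true; qa; e]; [:: true; false; qb; e];
          [:: qa; qb; false; ~~ e]; [:: e; e; ~~ e; false]] in
    found 4 P (half_split_witnesses 2 3) || nested P 3
  else true).
Proof. by vm_compute. Qed.

Lemma restrict2 P a b : restrict P [:: a; b] = table
     [:: [:: later P a a; later P a b];
      [:: later P b a; later P b b]]
     [:: [:: false; same_row P a b];
      [:: same_row P b a; false]].
Proof. by rewrite /restrict /= !same_rowxx. Qed.

Lemma restrict3 P a b c : restrict P [:: a; b; c] = table
     [:: [:: later P a a; later P a b; later P a c];
      [:: later P b a; later P b b; later P b c];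
      [:: later P c a; later P c b; later P c c]]
     [:: [:: false; same_row P a b; same_row P a c];
      [:: same_row P b a; false; same_row P b c];
      [:: same_row P c a; same_row P c b; false]].
Proof. by rewrite /restrict /= !same_rowxx. Qed.

Lemma restrict4 P a b c d : restrict P [:: a; b; c; d] = table
     [:: [:: later P a a; later P a b; later P a c; later P a d];
      [:: later P b a; later P b b; later P b c; later P b d];
      [:: later P c a; later P c b; later P c c; later P c d];
      [:: later P d a; later P d b; later P d c; later P d d]]
     [:: [:: false; same_row P a b; same_row P a c; same_row P a d];
      [:: same_row P b a; false; same_row P b c; same_row P b d];
      [:: same_row P c a; same_row P c b; false; same_row P c d];
      [:: same_row P d a; same_row P d b; same_row P d c; false]].
Proof. by rewrite /restrict /= !same_rowxx. Qed.

(** * Prime graphs without long chains *)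

Section Unavoidable.

Variables (C : graph_class) (t : nat).
Hypothesis hC : hereditary C.
Hypothesis short : forall w, has_word C w -> size w <= t.

Lemma found_listed n P cs : realized C n P -> found n P cs -> contains_listed C.
Proof.
rewrite /found => real /(has_nthP (0, mk_placement 0 0 0 0 (0, 0) (0, 0)))[m _].
case: (nth _ _ _) => i p /andP[/= it /andP[inc fit]]; exists i => //.
by have [p3 _] := templates_ok it; apply: realized_famAge real inc fit.
Qed.

Lemma split_found_realized n P cs :
  realized C n P -> split_found n P cs -> realized C 2 half_split.
Proof.
rewrite /split_found => real /hasP[c _ /orP[] /andP[inc fit]].
  exact: realized_template real inc fit.
exact: realized_template (realized_rev real) inc fit.
Qed.

(* The rows of P' are chains from the pairs in the rows of P to the vertex in
   column 0 and row 0 of P, which becomes column s. *)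
Lemma chain_columns (P : pattern) :
  (forall N, exists G (f : nat * nat -> fin_vertex G),
    [/\ C G, prime_graph G, array 2 N P f &
        forall k, 0 < k < N -> [/\ f (0, k) != f (1, k),
          f (0, 0) != f (0, k) & f (0, 0) != f (1, k)]]) ->
  exists P' s,
    [/\ 2 <= s, realized C s.+1 P',
        (forall i j, i < 2 -> j < 2 -> later P' i j = later P i j) /\
        same_row P' 0 1 = same_row P 0 1,
        (forall i j, j.+1 < i <= s -> same_row P' i j = ~~ same_row P' i i.-1) &
        (forall j, j <= s -> later P' s j = same_row P' s j /\
                             later P' j s = same_row P' s j) /\
        (same_row P' s 0 = later P 0 0 /\ same_row P' s 1 = later P 0 1)].
Proof.
move=> ex.
pose R (G : fin_graph) (f : nat * nat -> fin_vertex G) (h : nat -> 'I_t.+1) N :=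
  array 2 N P f /\ exists v, forall k, k < N ->
    [/\ 2 <= h k, f (nat_of_ord (h k), k) = v,
        forall i j, j.+1 < i <= h k ->
          fin_adj (f (i, k)) (f (j, k)) = ~~ fin_adj (f (i, k)) (f (i.-1, k)),
        fin_adj v (f (0, k)) = later P 0 0 & fin_adj v (f (1, k)) = later P 0 1].
have [|N|P' [a aP]] := @uniformize C 'I_t.+1 t.+1 R.
- move=> G f h g N n [arr [v vP]] gm gN; split; last first.
    by exists v => k kn; apply: vP; apply: gN.
  move=> [i k] [j l] /= i2 j2 kn ln; rewrite arr ?gN //.
  apply: padj_rows; case: (ltngtP k l) => [kl|lk|->]; rewrite ?ltnn //.
  - by rewrite gm ?kl.
  - by apply/negbTE; rewrite -leqNgt ltnW // gm ?lk.
  - by apply/negbTE; rewrite -leqNgt ltnW // gm ?kl.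
  - by rewrite gm ?lk.
(* Row 0 provides the common end [v] of the chains, so the new row [k] starts from the old row
   [k.+1]. *)
- have [G [f [CG pG arr ne]]] := ex N.+1.
  pose v := f (0, 0).
  have /(nat_choice (0, fun=> v))[W WP] : forall k, k < N ->
      exists mp : nat * (nat -> fin_vertex G), [/\ 2 <= mp.1,
        mp.2 0 = f (0, k.+1), mp.2 1 = f (1, k.+1), mp.2 mp.1 = v & chain mp.2 mp.1].
    move=> k kN; have [|xy vx vy] := ne k.+1; first by rewrite ltnS.
    by have [m [p [m2 p0 p1 pm pc]]] := chain_to pG xy vx vy; exists (m, p).
  have Wt k : k < N -> (W k).1 < t.+1.
    move=> /WP[_ _ _ _ pc]; rewrite ltnS.
    by have [w <- /short] := chain_has_word CG pc.
  exists G, (fun u => (W u.2).2 u.1), (fun k => inord (W k).1); split=> //; split.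
    have fE i k : i < 2 -> k < N -> (W k).2 i = f (i, k.+1).
      by move=> i2 /WP[_ p0 p1 _ _]; case: i i2 => [|[|]].
    by move=> [i k] [j l] /= i2 j2 kN lN; rewrite !fE // arr ?ltnS.
  exists v => k kN; have [m2 p0 p1 pm [_ pA]] := WP k kN.
  rewrite inordK ?Wt //=; split=> //.
  + by rewrite p0 (array_later arr).
  + by rewrite p1 (array_later arr).
exists P', (nat_of_ord a).
have [G [f [h [_ _ [arr2 [v vP]] ha arr]]]] := aP 3.
have ha0 : h 0 = a by apply: ha.
have ha1 : h 1 = a by apply: ha.
have [a2 v0 ch v00 v01] := vP 0 isT; rewrite ha0 in a2 v0 ch.
have [_ v1 _ v10 v11] := vP 1 isT; rewrite ha1 in v1.
have at1 : a < t.+1 by [].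
have le i : i <= a -> i < t.+1 by move=> ia; apply: leq_ltn_trans at1.
have sE i j : i <= a -> j <= a -> same_row P' i j = fin_adj (f (i, 0)) (f (j, 0)).
  by move=> ia ja; rewrite (array_row arr) ?le.
have lE i j : i <= a -> j <= a -> later P' i j = fin_adj (f (i, 0)) (f (j, 1)).
  by move=> ia ja; rewrite (array_later arr) ?le.
have sE1 i j : i <= a -> j <= a -> same_row P' i j = fin_adj (f (i, 1)) (f (j, 1)).
  by move=> ia ja; rewrite (array_row arr) ?le.
have a1 i : i < 2 -> i <= a by move=> i2; apply: leq_trans a2; apply: ltnW.
split=> //.
- move=> N; have [G' [f' [h' [CG' pG' _ _ arr']]]] := aP N.
  exists G', f'; split=> // u v' ua va; apply: arr'; exact: le.
- split=> [i j i2 j2|]; first by rewrite lE ?a1 // (array_later arr2).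
  by rewrite sE ?a1 // (array_row arr2).
- move=> i j /andP[ji ia]; have ja : j <= a by apply: leq_trans ia; rewrite ltnW // ltnW.
  by rewrite !sE ?(leq_trans (leq_pred _)) // ch ?ji.
- split; first move=> j ja.
    split; first by rewrite lE // sE1 // v0 v1.
    by rewrite lE // sE // v0 v1 fin_adj_sym.
  have a1' : 1 <= a by apply: a1.
  by split; rewrite sE // v0 ?v00 ?v01.
Qed.

Lemma two_columns_listed (P : pattern) : realized C 2 P ->
  same_row P 0 1 != later P 1 0 ->
  [\/ contains_listed C, realized C 2 half_split |
      exists c, (forall i j, i < 2 -> j < 2 -> later P i j = c) /\
                same_row P 0 1 = ~~ c].
Proof.
move=> real ne; have := @realized_restrict C 2 P [:: 0; 1] isT real.
have := all_bitsP (s := [:: later P 0 0; later P 0 1; later P 1 0; later P 1 1;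
  same_row P 0 1]) two_columns_check erefl.
cbv beta iota zeta.
rewrite restrict2 (same_rowC P 1 0).
rewrite (negbTE ne) orFb.
set Q := table _ _ => check realQ.
case/or4P: check => [ok|ok|/and5P[/eqP A /eqP B /eqP A' /eqP B' /eqP D]|
    /and5P[/eqP A /eqP B /eqP A' /eqP B' /eqP D]].
- by constructor 1; apply: found_listed realQ ok.
- by constructor 2; apply: split_found_realized realQ ok.
- constructor 3; exists false; split=> [[|[|i]] [|[|j]]|] //; exact: D.
- constructor 3; exists true; split=> [[|[|i]] [|[|j]]|] //; exact: D.
Qed.

Section Chained.

Variables (P : pattern) (s : nat).
Hypothesis real : realized C s.+1 P.
Hypothesis pred_special :
  forall i j, j.+1 < i <= s -> same_row P i j = ~~ same_row P i i.-1.
Hypothesis const : forall j, j <= s ->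
  later P s j = same_row P s j /\ later P j s = same_row P s j.

(** Induction along the chain by [matching_check]. Column [s] is matched with no column, because it
    sees a column in its own row as in the other rows. *)
Lemma matching_chain_listed c x y : x < y <= s ->
  later P x x = c -> later P x y = c -> later P y x = c -> later P y y = c ->
  same_row P x y = ~~ c ->
  contains_listed C \/ realized C 2 half_split.
Proof.
move: {2}(s - y) (erefl (s - y)) => d; elim: d x y => [|d IH] x y dE /andP[xy ys].
  have -> : y = s by apply/eqP; rewrite eqn_leq ys -subn_eq0 dE.
  move=> _ _ sx _ xs; have [E _] := const (leq_trans (ltnW xy) ys).
  by move: xs; rewrite same_rowC -E sx; case: (c).
have ys' : y < s by rewrite -subn_gt0 dE.
move=> xx xy' yx yy q.
have px : same_row P y.+1 x = ~~ same_row P y.+1 y by rewrite pred_special // ltnS xy.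
have := @realized_restrict C s.+1 P [:: x; y; y.+1] _ real.
rewrite /= !ltnS ys ys' (leq_trans (ltnW xy) ys) => /(_ isT).
have := all_bitsP (s := [:: c; later P y.+1 x; later P y.+1 y; later P y.+1 y.+1;
  later P x y.+1; later P y y.+1; same_row P y.+1 x]) matching_check erefl.
cbv beta iota zeta.
rewrite restrict3.
rewrite (same_rowC P x y.+1) (same_rowC P y y.+1) (same_rowC P y x) xx xy' yx yy q.
have -> : same_row P y.+1 y = ~~ same_row P y.+1 x by rewrite px negbK.
set Q := table _ _ => check realQ.
have dE' : s - y.+1 = d by rewrite subnS dE.
case/or4P: check => [ok|ok|/and5P[_ /eqP A /eqP A' /eqP B /eqP D]|
    /and5P[_ /eqP A /eqP A' /eqP B /eqP D]].
- by left; apply: found_listed realQ ok.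
- by right; apply: split_found_realized realQ ok.
- apply: (IH x y.+1 dE') => //; first by rewrite ltnW ?ltnS.
  by rewrite same_rowC; exact: D.
- apply: (IH y y.+1 dE') => //; first by rewrite ltnSn.
  rewrite same_rowC -[same_row P _ _]negbK -px; exact: D.
Qed.

Hypotheses (P00 : later P 0 0 = false) (P01 : later P 0 1 = false)
  (P10 : later P 1 0 = true) (P11 : later P 1 1 = true)
  (Pq : same_row P 0 1 = true).
Hypotheses (Ps0 : same_row P s 0 = false) (Ps1 : same_row P s 1 = false).

(** By [nested_check], nestedness passes to the next column unless a listed graph appears. It cannot
    reach column [s], which sees nothing of column 1. *)
Lemma nested_listed m : 1 < m <= s -> nested P m -> contains_listed C.
Proof.
move: {2}(s - m) (erefl (s - m)) => d; elim: d m => [|d IH] m dE /andP[m1 ms].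
  have -> : m = s by apply/eqP; rewrite eqn_leq ms -subn_eq0 dE.
  case/and4P=> _ _ _; have [_ ->] := const (leq_trans (ltnW m1) ms).
  by rewrite Ps1.
have ms' : m < s by rewrite -subn_gt0 dE.
case/and4P=> /eqP mE0 /eqP mE1 /negbTE m0 m1'.
have p0 : same_row P m.+1 0 = ~~ same_row P m.+1 m.
  by rewrite pred_special // ltnS (ltnW m1).
have p1 : same_row P m.+1 1 = ~~ same_row P m.+1 m.
  by rewrite pred_special // ltnS m1.
have := @realized_restrict C s.+1 P [:: 0; 1; m; m.+1] _ real.
rewrite /= !ltnS ms ms' (leq_trans (ltnW m1) ms) => /(_ isT).
have := all_bitsP (s := [:: later P m m; same_row P 0 m; same_row P 1 m;
  same_row P m.+1 0; later P m.+1 0; later P m.+1 1; later P m.+1 m;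
  later P m.+1 m.+1; later P 0 m.+1; later P 1 m.+1; later P m m.+1])
  nested_check erefl.
cbv beta iota zeta.
rewrite restrict4.
rewrite (same_rowC P 0 m.+1) (same_rowC P 1 m.+1) (same_rowC P m m.+1).
rewrite (same_rowC P m 0) (same_rowC P m 1) (same_rowC P 1 0) p1 -p0.
have -> : same_row P m.+1 m = ~~ same_row P m.+1 0 by rewrite p0 negbK.
rewrite mE0 mE1 m0 m1' P00 P01 P10 P11 Pq.
set Q := table _ _ => check realQ.
case/orP: check => [|nest]; first exact: found_listed realQ.
apply: (IH m.+1); first by rewrite subnS dE.
  by rewrite ltnW.
exact: nest.
Qed.

Lemma half_split_chain_listed : 1 < s -> contains_listed C.
Proof.
move=> s1; have p1 : same_row P 2 1 = ~~ same_row P 2 0.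
  by rewrite [same_row P 2 0]pred_special ?negbK.
(* Column 2 separates columns 0 and 1 inside a row, whereas column [s] sees neither of them. *)
have s2 : 2 < s.
  rewrite ltn_neqAle s1 andbT; apply/eqP => E.
  by have := Ps1; rewrite -E p1 E Ps0.
have := @realized_restrict C s.+1 P [:: 0; 1; 2] _ real.
rewrite [all _ _]/= !ltnS (ltnW s1) s1 => /(_ isT).
have := all_bitsP (s := [:: later P 2 0; later P 2 1; later P 2 2; later P 0 2;
  later P 1 2; same_row P 2 0]) half_split_check erefl.
cbv beta iota zeta.
rewrite restrict3 (same_rowC P 0 2) (same_rowC P 1 2) (same_rowC P 1 0).
rewrite p1 P00 P01 P10 P11 Pq.
set Q := table _ _ => check realQ.
case/or3P: check => [ok|nest|infty]; first exact: found_listed realQ ok.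
  by apply: (@nested_listed 2); rewrite ?s1.
case/and5P: infty => /negbTE A0 A1 /negbTE B0 B1 /negbTE q0.
have z0 : same_row P 3 0 = ~~ same_row P 3 2 by rewrite pred_special.
have z1 : same_row P 3 1 = ~~ same_row P 3 2 by rewrite pred_special.
have := @realized_restrict C s.+1 P [:: 0; 1; 2; 3] _ real.
rewrite [all _ _]/= !ltnS (ltnW s1) s1 s2 => /(_ isT).
have := all_bitsP (s := [:: later P 2 2; same_row P 3 0; later P 3 0; later P 3 1;
  later P 3 2; later P 3 3; later P 0 3; later P 1 3; later P 2 3])
  apex_check erefl.
cbv beta iota zeta.
rewrite restrict4 (same_rowC P 0 3) (same_rowC P 1 3) (same_rowC P 2 3).
rewrite (same_rowC P 0 2) (same_rowC P 1 2) (same_rowC P 1 0) z1 -z0.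
have -> : same_row P 3 2 = ~~ same_row P 3 0 by rewrite z0 negbK.
rewrite p1 q0 A0 A1 B0 B1 P00 P01 P10 P11 Pq.
set Q' := table _ _ => check realQ'.
case/orP: check => [|nest]; first exact: found_listed realQ'.
by apply: (@nested_listed 3); rewrite ?s2.
Qed.

End Chained.

Lemma half_split_listed : realized C 2 half_split -> contains_listed C.
Proof.
move=> real.
have [N|P [s [s2 realP [lP qP] spec [const [s0 s1]]]]] := @chain_columns half_split.
  have [G [f [CG pG fA]]] := real N; exists G, f; split=> // k /andP[k0 kN].
  have lt0 : 0 < N by apply: leq_ltn_trans kN.
  split; apply/eqP => E.
  - by have := fA (0, k) (1, k) isT isT kN kN; rewrite E fin_adj_irrefl /padj /= ltnn.
  - have := fA (0, 0) (1, k) isT isT lt0 kN; rewrite E fA //.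
    by rewrite /padj /= ltnn k0.
  - have := fA (0, 0) (0, k) isT isT lt0 kN; rewrite E fA //.
    by rewrite /padj /= ltnn k0.
apply: (half_split_chain_listed realP spec const) => //; by rewrite ?lP.
Qed.

(** The two vertices of a row are assumed distinct since, for [c] true, adjacency alone would allow
    them to coincide. *)
Lemma matching_listed (P : pattern) c :
  (forall N, exists G (f : nat * nat -> fin_vertex G),
    [/\ C G, prime_graph G, array 2 N P f & forall k, k < N -> f (0, k) != f (1, k)]) ->
  (forall i j, i < 2 -> j < 2 -> later P i j = c) -> same_row P 0 1 = ~~ c ->
  contains_listed C.
Proof.
move=> real lc qc.
have [N|P' [s [s2 realP [lP qP] spec [const _]]]] := @chain_columns P.
  have [G [f [CG pG fA ne]]] := real N; exists G, f; split=> // k /andP[k0 kN].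
  have lt0 : 0 < N by apply: leq_ltn_trans kN.
  have far i j : i < 2 -> j < 2 -> fin_adj (f (i, 0)) (f (j, k)) = c.
    by move=> i2 j2; rewrite (array_later fA) ?k0 ?lc.
  split; first exact: ne; apply/eqP => E.
    have := far 0 1 isT isT; rewrite E (array_row fA) // qc.
    by case: (c).
  have := far 0 0 isT isT; rewrite E (array_row fA) // same_rowC qc.
  by case: (c).
have [//|] : contains_listed C \/ realized C 2 half_split.
  by apply: (matching_chain_listed realP spec const (c := c) (x := 0) (y := 1));
    rewrite ?lP ?lc ?qP ?(ltnW s2).
exact: half_split_listed.
Qed.

(* Splitting by a vertex that separates two members and keeping the larger half. *)
Lemma halving (G : fin_graph) : prime_graph G -> 2 < #|fin_vertex G| ->
  forall n (A : {set fin_vertex G}), 2 ^ n <= #|A| ->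
  exists a d : nat -> fin_vertex G,
    [/\ forall k, k < n -> a k \in A, forall k, k < n -> a k != d k &
        forall k l, k < l < n -> fin_adj (d k) (a k) != fin_adj (d k) (a l)].
Proof.
move=> pG lt2; elim=> [|n IH] A.
  by rewrite card_gt0 => /set0Pn[x _]; exists (fun=> x), (fun=> x); split=> // k l; lia.
move=> An; have : 1 < #|A| by apply: leq_trans An; rewrite -[1](expn0 2) ltn_exp2l.
case/card_gt1P => x [y [xA yA xy]].
have [d [dx dy dxy]] := prime_distinguish pG xy lt2.
pose half b := [set z in A | fin_adj d z == b].
have split_card : #|half true| + #|half false| = #|A|.
  rewrite -[RHS](cardsID [set z | fin_adj d z]); congr (_ + _); apply: eq_card => z;
    by rewrite !inE; case: (fin_adj d z); rewrite ?andbT ?andbF.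
have [b bn] : exists b, 2 ^ n <= #|half b|.
  case: (leqP (2 ^ n) #|half true|) => lt; first by exists true.
  exists false; rewrite -(leq_add2l #|half true|) split_card.
  by apply: leq_trans An; rewrite expnS mul2n -addnn leq_add2r ltnW.
have [z [zA dz zb]] : exists z, [/\ z \in A, d != z & fin_adj d z != b].
  case: (eqVneq (fin_adj d x) b) => xb; last by exists x.
  by exists y; split=> //; rewrite -xb eq_sym.
have [a [e [aA ae sep]]] := IH _ bn.
exists (fun k => if k is k'.+1 then a k' else z),
  (fun k => if k is k'.+1 then e k' else d); split.
- by case=> [|k] // kn; have := aA k kn; rewrite inE => /andP[].
- by case=> [|k] //; [rewrite eq_sym|apply: ae].
case=> [|k] [|l] //= kl; last exact: sep.
by have := aA l kl; rewrite inE => /andP[_ /eqP->].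
Qed.

Lemma unavoidable : ~ finitely_many_primes C -> contains_listed C.
Proof.
move=> inf.
pose R (G : fin_graph) (f : nat * nat -> fin_vertex G) (h : nat -> unit) N :=
  (forall k, k < N -> f (0, k) != f (1, k)) /\
  forall k l, k < l < N -> fin_adj (f (1, k)) (f (0, k)) != fin_adj (f (1, k)) (f (0, l)).
have [|N|P [a aP]] := @uniformize C unit 2 R.
- move=> G f h g N n [ne sep] gm gN; split=> [k kn|k l kl] /=.
    by apply: ne; apply: gN.
  by apply: sep; rewrite gm // gN //; case/andP: kl.
(* The power of 2 serves [N] halvings, and the 3 ensures the third vertex needed to separate a
   pair. *)
- have [G [CG pG big]] := large_primes inf (2 ^ N + 3).
  have lt2 : 2 < #|fin_vertex G| by apply: leq_trans big; rewrite addnC.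
  have [|a [d [_ ad sep]]] := @halving G pG lt2 N setT.
    by rewrite cardsT (leq_trans _ big) ?leq_addr.
  by exists G, (fun u => if u.1 == 0 then a u.2 else d u.2), (fun=> tt).
have real : realized C 2 P.
  by move=> N; have [G [f [h [CG pG _ _ fA]]]] := aP N; exists G, f.
have ne : same_row P 0 1 != later P 1 0.
  have [G [f [h [_ _ [_ sep] _ fA]]]] := aP 2.
  by have := sep 0 1 isT; rewrite (array_row fA) // (array_later fA) // same_rowC.
case: (two_columns_listed real ne) => [//|/half_split_listed //|[c [lc qc]]].
apply: (matching_listed _ lc qc) => N.
by have [G [f [h [CG pG [dist _] _ fA]]]] := aP N; exists G, f.
Qed.

End Unavoidable.

(** * The eleven graphs *)

Lemma valid_neg F u : valid (neg_template F) u = valid F u.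
Proof. by rewrite /valid size_map. Qed.

Lemma fam_same_neg F i j : i < j < 2 + size (consts F) ->
  fam_same (neg_template F) i j = ~~ fam_same F i j.
Proof.
case/andP=> ij jF; case: i j ij jF => [|[|i]] [|[|j]] //= _ jF;
  by rewrite (nth_map (false, false)).
Qed.

Lemma padj_neg F u v : valid F u -> valid F v ->
  padj (neg_template F) u v = (u != v) && ~~ padj F u v.
Proof.
wlog le : u v / u.1 <= v.1.
  move=> wl vu vv; case: (leqP u.1 v.1) => le; first exact: wl.
  by rewrite padjC eq_sym [padj F u v]padjC; apply: wl => //; apply: ltnW.
move=> vu vv; case: (eqVneq u v) => [->|uv]; first by rewrite padjxx.
case: (ltnP v.1 2) => v2.
  have u2 := leq_ltn_trans le v2.
  case: u v uv u2 v2 {vu vv le} => [i k] [j l] /= uv i2 j2.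
  have later_neg x y : x < 2 -> y < 2 ->
      fam_later (neg_template F) x y = ~~ fam_later F x y.
    by case: x => [|[|]] //; case: y => [|[|]].
  rewrite /padj /=; case: ltngtP => [_|_|kl]; rewrite ?later_neg //.
  rewrite /same_row; case: ltngtP => [ij|ji|ij] /=.
  - by rewrite fam_same_neg // ij ltn_addr.
  - by rewrite fam_same_neg // ji ltn_addr.
  - by rewrite ij kl eqxx in uv.
rewrite padjC [padj F u v]padjC !fam_const ?valid_neg // [same_row F _ _]same_rowC.
rewrite same_rowC /same_row; move: le; rewrite leq_eqVlt => /predU1P[E|lt].
  case/eqP: uv; move: vu vv; rewrite /valid E ltnNge v2 /= =>
    /andP[_ /eqP u0] /andP[_ /eqP v0].
  by case: u v E u0 v0 {v2} => ? ? [? ?] /= -> -> ->.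
rewrite lt /= fam_same_neg // lt /=.
by move: vv; rewrite /valid ltnNge v2 => /andP[].
Qed.

Lemma coded_Age (Z : graph) (F : template) (h : Z -> nat * nat) (g : nat * nat -> Z) :
  (forall x, valid F (h x)) -> cancel h g -> (forall u, valid F u -> h (g u) = u) ->
  (forall x y, adj x y = padj F (h x) (h y)) ->
  class_eq (Age Z) (famAge F).
Proof.
move=> hV hK gK hA H; split=> [/embedsP[f [fI fA]]|[f [fI fV fA]]].
  exists (fun x => h (f x)); split=> [x y /(can_inj hK)/fI //|x //|x y].
  by rewrite -hA fA.
apply/embedsP; exists (fun x => g (f x)); split=> [x y E|x y].
  by apply: fI; rewrite -[f x]gK // E gK.
by rewrite hA !gK // -fA.
Qed.

Lemma coded_Age_complement (Z : graph) (F : template) (h : Z -> nat * nat)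
    (g : nat * nat -> Z) :
  (forall x, valid F (h x)) -> cancel h g -> (forall u, valid F u -> h (g u) = u) ->
  (forall x y, adj x y = padj F (h x) (h y)) ->
  class_eq (Age (complement Z)) (famAge (neg_template F)).
Proof.
move=> hV hK gK hA; apply: (@coded_Age (complement Z) _ h g) => //.
- by move=> x; rewrite valid_neg.
- by move=> u; rewrite valid_neg; apply: gK.
- by move=> x y; rewrite padj_neg // (inj_eq (can_inj hK)) -hA.
Qed.

Definition sum_pos (x : nat + nat) : nat * nat :=
  match x with inl i => (0, i) | inr i => (1, i) end.
Definition pos_sum (u : nat * nat) : nat + nat :=
  if u.1 == 0 then inl u.2 else inr u.2.

Definition option_sum_pos (x : option (nat + nat)) : nat * nat :=
  if x is Some y then sum_pos y else (2, 0).
Definition pos_option_sum (u : nat * nat) : option (nat + nat) :=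
  if u.1 < 2 then Some (pos_sum u) else None.

Definition F_pos (x : option (option nat + nat)) : nat * nat :=
  match x with
  | None => (3, 0)
  | Some (inl None) => (2, 0)
  | Some (inl (Some i)) => (0, i)
  | Some (inr i) => (1, i)
  end.
Definition pos_F (u : nat * nat) : option (option nat + nat) :=
  match u.1 with
  | 0 => Some (inl (Some u.2))
  | 1 => Some (inr u.2)
  | 2 => Some (inl None)
  | _ => None
  end.

Lemma sum_posK : cancel sum_pos pos_sum.
Proof. by case. Qed.

Lemma pos_sumK F u : consts F = [::] -> valid F u -> sum_pos (pos_sum u) = u.
Proof. by move=> F0; rewrite /valid F0; case: u => [[|[|]] ?]. Qed.

Lemma option_sum_posK : cancel option_sum_pos pos_option_sum.
Proof. by case=> [[]|]. Qed.

Lemma pos_option_sumK F u : size (consts F) = 1 -> valid F u ->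
  option_sum_pos (pos_option_sum u) = u.
Proof. by move=> F1; rewrite /valid F1; case: u => [[|[|[|]]] [|?]]. Qed.

Lemma F_posK : cancel F_pos pos_F.
Proof. by case=> [[[]|]|]. Qed.

Lemma pos_FK F u : size (consts F) = 2 -> valid F u -> F_pos (pos_F u) = u.
Proof. by move=> F2; rewrite /valid F2; case: u => [[|[|[|[|]]]] [|?]]. Qed.

Lemma adj_S x y : @adj graph_S x y = padj template_S (option_sum_pos x)
  (option_sum_pos y).
Proof.
case: x y => [[i|i]|] [[j|j]|]; rewrite /adj /= /sym_adj /S_rel /padj /same_row /=;
  first [done | by case: (ltngtP i j) | by case: (ltngtP i 0) |
    by case: (ltngtP j 0)].
Qed.

Lemma adj_B x y : @adj graph_B x y = padj template_B (sum_pos x) (sum_pos y).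
Proof.
case: x y => [i|i] [j|j]; rewrite /adj /= /sym_adj /B_rel /padj /same_row /= ?orbF /=;
  first [done | by case: (ltngtP i j) | by case: (ltngtP i 0) |
    by case: (ltngtP j 0)].
Qed.

Lemma adj_M x y : @adj graph_M x y = padj template_M (sum_pos x) (sum_pos y).
Proof.
case: x y => [i|i] [j|j]; rewrite /adj /= /sym_adj /M_rel /padj /same_row /= ?orbF /=;
  first [done | by case: (ltngtP i j) | by case: (ltngtP i 0) |
    by case: (ltngtP j 0)].
Qed.

Lemma adj_T x y : @adj graph_T x y = padj template_T (sum_pos x) (sum_pos y).
Proof.
case: x y => [i|i] [j|j]; rewrite /adj /= /sym_adj /T_rel /padj /same_row /= ?orbF /=;
  first [done | by case: (ltngtP i j) | by case: (ltngtP i 0) |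
    by case: (ltngtP j 0)].
Qed.

Lemma adj_D x y : @adj graph_D x y = padj template_D (option_sum_pos x)
  (option_sum_pos y).
Proof.
case: x y => [[i|i]|] [[j|j]|]; rewrite /adj /= /sym_adj /D_rel /padj /same_row /=;
  first [done | by case: (ltngtP i j) | by case: (ltngtP i 0) |
    by case: (ltngtP j 0)].
Qed.

Lemma adj_F x y : @adj graph_F x y = padj template_F (F_pos x) (F_pos y).
Proof.
case: x y => [[[i|]|i]|] [[[j|]|j]|]; rewrite /adj /= /sym_adj /F_rel /padj /same_row /=;
  first [done | by case: (ltngtP i j) | by case: (ltngtP i 0) |
    by case: (ltngtP j 0)].
Qed.

Lemma class_eq_sym (C D : graph_class) : class_eq C D -> class_eq D C.
Proof. by move=> CD G; split=> [/(proj2 (CD G))|/(proj1 (CD G))]. Qed.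

Lemma class_eq_trans (C D E : graph_class) :
  class_eq C D -> class_eq D E -> class_eq C E.
Proof.
move=> CD DE G; split=> [/(proj1 (CD G))/(proj1 (DE G))|] //.
by move=> /(proj2 (DE G))/(proj2 (CD G)).
Qed.

Lemma list_L_templates i : i < size templates ->
  class_eq (nth (Age graph_S) list_L i) (famAge (template_at i)).
Proof.
have V1 (F : template) x : size (consts F) = 1 -> valid F (option_sum_pos x).
  by rewrite /valid => ->; case: x => [[]|].
have V0 (F : template) x : valid F (sum_pos x) by case: x.
have V2 x : valid template_F (F_pos x) by case: x => [[[]|]|].
have K0 (F : template) : consts F = [::] ->
  forall u, valid F u -> sum_pos (pos_sum u) = u by move=> F0 u; apply: pos_sumK.
have K1 (F : template) : size (consts F) = 1 ->
    forall u, valid F u -> option_sum_pos (pos_option_sum u) = u.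
  by move=> F1 u; apply: pos_option_sumK.
have K2 : forall u, valid template_F u -> F_pos (pos_F u) = u.
  by move=> u; apply: pos_FK.
have S1 := fun x => V1 template_S x erefl.
have D1 := fun x => V1 template_D x erefl.
case: i => [|[|[|[|[|[|[|[|[|[|[|i]]]]]]]]]]] // _.
- exact: (@coded_Age graph_S template_S option_sum_pos pos_option_sum
    S1 option_sum_posK (K1 template_S erefl) adj_S).
- exact: (@coded_Age_complement graph_S template_S option_sum_pos pos_option_sum
    S1 option_sum_posK (K1 template_S erefl) adj_S).
- exact: (@coded_Age graph_B template_B sum_pos pos_sum
    (V0 template_B) sum_posK (K0 template_B erefl) adj_B).
- exact: (@coded_Age_complement graph_B template_B sum_pos pos_sum
    (V0 template_B) sum_posK (K0 template_B erefl) adj_B).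
- exact: (@coded_Age graph_M template_M sum_pos pos_sum
    (V0 template_M) sum_posK (K0 template_M erefl) adj_M).
- exact: (@coded_Age_complement graph_M template_M sum_pos pos_sum
    (V0 template_M) sum_posK (K0 template_M erefl) adj_M).
- exact: (@coded_Age graph_T template_T sum_pos pos_sum
    (V0 template_T) sum_posK (K0 template_T erefl) adj_T).
- exact: (@coded_Age_complement graph_T template_T sum_pos pos_sum
    (V0 template_T) sum_posK (K0 template_T erefl) adj_T).
- exact: (@coded_Age graph_D template_D option_sum_pos pos_option_sum
    D1 option_sum_posK (K1 template_D erefl) adj_D).
- exact: (@coded_Age graph_F template_F F_pos pos_F
    V2 F_posK K2 adj_F).
- exact: (@coded_Age_complement graph_F template_F F_pos pos_F
    V2 F_posK K2 adj_F).
Qed.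

Lemma list_L_nth (A : graph_class) : List.In A list_L ->
  exists2 i, i < size templates & A = nth (Age graph_S) list_L i.
Proof.
rewrite -[size templates]/(size list_L).
elim: list_L => //= B s IH [<-|/IH[i iB ->]]; first by exists 0.
by exists i.+1.
Qed.

Lemma nth_list_L i : i < size templates ->
  List.In (nth (Age graph_S) list_L i) list_L.
Proof.
rewrite -[size templates]/(size list_L).
elim: list_L i => // B s IH [|i] /=; [by left|by move/IH; right].
Qed.

Theorem theorem23 (C : graph_class) (hC : hereditary C) :
  minimal_prime C <->
  (exists mu : word, uniformly_recurrent mu /\ class_eq C (Age (G_word mu))) \/
  (exists2 A : graph_class, List.In A list_L & class_eq C A).
Proof.
split=> [minC|[[mu [rec CE]]|[A /list_L_nth[i it ->] CE]]].
- case: (classic (unbounded (has_word C))) => [unb|bnd]; [left|right].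
    have [mu rec sub] := unbounded_words hC unb; exists mu; split=> //.
    have [hW infW _] := wordAge_minimal_prime rec.
    have CW := minimal_prime_sub minC hW infW sub.
    exact: class_eq_trans CW (class_eq_sym (Age_word mu)).
  have [t short] : exists t, forall w, has_word C w -> size w <= t.
    apply: NNPP => none; apply: bnd => n; apply: NNPP => nn; apply: none.
    exists n => w Cw; rewrite leqNgt; apply/negP => lt; apply: nn.
    by exists w => //; apply: ltnW.
  have [_ infC _] := minC; have [i it sub] := unavoidable hC short infC.
  have [p3 ess] := templates_ok it.
  have [hF infF _] := famAge_minimal_prime p3 ess.
  exists (nth (Age graph_S) list_L i); first exact: nth_list_L.
  apply: class_eq_trans (minimal_prime_sub minC hF infF sub) _.
  exact: class_eq_sym (list_L_templates it).
- apply: minimal_prime_eq (wordAge_minimal_prime rec).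
  exact: class_eq_trans CE (Age_word mu).
- have [p3 ess] := templates_ok it.
  apply: minimal_prime_eq (famAge_minimal_prime p3 ess).
  exact: class_eq_trans CE (list_L_templates it).
Qed.
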